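(* Let $d,p\ge1$ be integers and $q=1$, let $A\in\mathcal{M}_d(\mathbb{C})$, $B\in\mathcal{M}_{d,p}(\mathbb{C})$, $C\in\mathcal{M}_{1,d}(\mathbb{C})$, $D\in\mathcal{M}_{1,p}(\mathbb{C})$, let $0<\tau<\infty$, and let $\mathcal{Y}(0,\tau):=\mathbb{F}L^2(0,\tau;\mathbb{C}^p)$ be the range of the associated input-output map. Then $\mathcal{Y}(0,\tau)$ satisfies the following alternative: - If $D\neq0$, then $\mathcal{Y}(0,\tau)=L^2(0,\tau)$. - If $D=0$ and $CA^kB=0$ for all integers $0\le k\le d-1$, then $\mathcal{Y}(0,\tau)=\{0\}$. - If $D=0$ and $\nu\in\{0,\dots,d-1\}$ is such that $CB=\dots=CA^{\nu-1}B=0$ and $CA^\nu B\neq0$, then $\mathcal{Y}(0,\tau)=H^{\nu+1}_{(0)}(0,\tau)$.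
   Context: The system is $\dot x(t)=Ax(t)+Bu(t)$, $x(0)=0$, $y(t)=Cx(t)+Du(t)$. Its input-output map is $\mathbb{F}:u\mapsto y$, $L^2(0,\tau;\mathbb{C}^p)\to L^2(0,\tau)$ (complex valued functions), with $$y(t)=\int_0^t Ce^{(t-\sigma)A}Bu(\sigma)\,d\sigma+Du(t).$$ For $L\in\mathbb{N}$, $H^L_{(0)}(0,\tau)=\{f\in H^L(0,\tau): f(0)=\dots=f^{(L-1)}(0)=0\}$, where $H^L$ is the Sobolev space of order $L$ based on $L^2$. *)

(* Defs.v *)
(* The real line is an arbitrary [R : realType], the complex field is [R[i]].
   A space of (classes of) functions on the interval (0, tau) is a set of
   almost-everywhere classes; representatives are functions on the whole of R,
   of which only the values on (0, tau) matter. *)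
From HB Require Import structures.
From mathcomp Require Export all_boot all_order all_algebra.
From mathcomp Require Export complex.
From mathcomp Require Export all_classical all_reals all_analysis.
Export Order.TTheory GRing.Theory Num.Theory.
Export numFieldNormedType.Exports.

Set Implicit Arguments.
Unset Strict Implicit.
Unset Printing Implicit Defensive.

Local Open Scope classical_set_scope.
Local Open Scope ring_scope.
Local Open Scope complex_scope.

(* The topology and norm of [R[i]], inherited from its numFieldType structure. *)
HB.instance Definition _ (R : rcfType) := NormedModule.copy R[i] (R[i]^o).

Section defs.
Context {R : realType}.
Implicit Types (tau t : R) (f g : R -> R[i]).

Local Notation mu := (@lebesgue_measure R).
Local Notation normc := ComplexField.Normc.normc.

(* Meaningful when [complex.Re \o f] and [complex.Im \o f] are integrable
   on [E]. *)
Definition cintegral (E : set R) f : R[i] :=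
  (\int[mu]_(x in E) complex.Re (f x)) +i* (\int[mu]_(x in E) complex.Im (f x)).

Definition cmeasurable_fun (E : set R) f : Prop :=
  measurable_fun E (fun x => complex.Re (f x)) /\
  measurable_fun E (fun x => complex.Im (f x)).

(* Representatives of the elements of L^2(0, tau). *)
Definition square_integrable tau : set (R -> R[i]) :=
  [set f | cmeasurable_fun `]0, tau[ f /\
    (\int[mu]_(x in `]0%R, tau[) (normc (f x) ^+ 2)%:E < +oo)%E].

(* Representatives of the elements of L^2(0, tau; C^n), C^n carrying the
   Euclidean norm. *)
Definition vsquare_integrable tau n : set (R -> 'cV[R[i]]_n) :=
  [set u | (forall i : 'I_n, cmeasurable_fun `]0, tau[ (fun x => u x i ord0)) /\
    (\int[mu]_(x in `]0%R, tau[)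
      (\sum_(i < n) normc (u x i ord0) ^+ 2)%:E < +oo)%E].

Definition ae_class tau f : set (R -> R[i]) :=
  [set g | f = g %[ae mu in `]0, tau[%classic]].

Definition L2 tau : set (set (R -> R[i])) :=
  ae_class tau @` square_integrable tau.

Definition expmx d (M : 'M[R[i]]_d) : 'M[R[i]]_d :=
  limn (series (fun k => k`!%:R^-1 *: M ^+ k)).

Section io.
Variables d p : nat.
Variables (A : 'M[R[i]]_d) (B : 'M[R[i]]_(d, p)).
Variables (C : 'M[R[i]]_(1, d)) (D : 'M[R[i]]_(1, p)).

Definition io_map (u : R -> 'cV[R[i]]_p) t : R[i] :=
  cintegral `[0, t]
    (fun s => (C *m expmx ((t - s)%:C *: A) *m B *m u s) ord0 ord0)
  + (D *m u t) ord0 ord0.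

Definition io_range tau : set (set (R -> R[i])) :=
  [set ae_class tau (io_map u) | u in @vsquare_integrable tau p].

End io.

(* Test functions: C_c^oo((0, tau)). Real-valued ones suffice to test complex
   functions, by linearity. *)
Definition test_function tau (phi : R -> R) : Prop :=
  (forall n x, derivable (derive1n n phi) x 1) /\
  (exists a b : R, [/\ 0 < a, b < tau &
     forall x, x \notin `[a, b] -> phi x = 0]).

(* [g] is the [k]-th distributional derivative of [f] on (0, tau); both are
   meant to be locally integrable there. *)
Definition weak_derivative tau k f g : Prop :=
  forall phi, test_function tau phi ->
    cintegral `]0, tau[ (fun x => f x * (derive1n k phi x)%:C) =
    (-1) ^+ k * cintegral `]0, tau[ (fun x => g x * (phi x)%:C).

(* Representatives of the elements of H^L(0, tau). *)
Definition sobolev tau L : set (R -> R[i]) :=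
  [set f | square_integrable tau f /\
    forall k, (k <= L)%N ->
      exists2 g, square_integrable tau g & weak_derivative tau k f g].

(* f^(k)(0) = c. As f^(k) is only defined almost everywhere on (0, tau), its
   value at 0 is that of its representative continuous on [0, tau], which exists
   when f is in H^L(0, tau) with k < L, and is unique. *)
Definition derivative_at0 tau k f (c : R[i]) : Prop :=
  exists g, [/\ {within `[0, tau], continuous g},
    weak_derivative tau k f g & g 0 = c].

Definition H0 tau L : set (set (R -> R[i])) :=
  ae_class tau @` [set f | sobolev tau L f /\
    forall k, (k < L)%N -> derivative_at0 tau k f 0].

End defs.

(* Main.v *)
Require Import Defs.
From mathcomp Require Import measurable_realfun ring lra.

Set Implicit Arguments.
Unset Strict Implicit.
Unset Printing Implicit Defensive.

Local Open Scope classical_set_scope.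
Local Open Scope ring_scope.
Local Open Scope complex_scope.

(** The state x(t) = int_0^t e^((t - s) A) B u(s) ds is the unique continuous
    solution of x(t) = int_0^t (A x + B u) ([solution_duhamel],
    [duhamel_solution]), and the output is y = Cx + Du. Everything else is deduced
    from this integral equation, itself obtained from the matrix exponential by an
    integration by parts against primitives of integrable functions
    ([Rintegral_by_parts_primitive]).

    If D <> 0, the system is inverted by feedback: choose an input component j with
    D_j <> 0 and solve y = Cx + D_j v for the input v in terms of the output y.
    Substituting, x solves a linear equation driven by y, so x is determined by any
    y in L^2, and then so is v ([io_map_onto]). By uniqueness of solutions this v
    does produce y, and the range is L^2 ([io_range_feedthrough]).

    If D = 0 and C A^k B = 0 for k < d, Cayley-Hamilton extends this to all k, the
    kernel C e^(tA) B vanishes and so does the output ([io_range_zero]).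

    If D = 0, then y = Cx is the primitive of CAx + CBu, the output of the system
    (A, B, CA, CB). Repeating this while C A^k B = 0, the output y is the
    (nu + 1)-fold primitive of the output of (A, B, C A^(nu+1), C A^nu B), which has
    nonzero feedthrough and hence range L^2. So the range consists of the
    (nu + 1)-fold primitives of L^2 functions ([io_range_integrated]).

    It remains to identify H^L_(0) with the L-fold primitives of L^2 functions
    ([H0_iter_cprimitive]). Primitives are weak primitives, again by the integration
    by parts. Conversely, when f^(k+1) is known, f^(k) and the primitive of f^(k+1)
    have the same weak derivative, so they differ by a constant ([du_bois_reymond]),
    which vanishes by the condition at 0. Du Bois-Reymond's lemma rests on explicit
    smooth bumps approximating the indicators of intervals ([bump_fundamental]). *)

Local Notation Re := (@complex.Re _).
Local Notation Im := (@complex.Im _).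
Local Notation normc := (@ComplexField.Normc.normc _).

(** * Complex numbers through their real and imaginary parts *)

Section complex_parts.
Context {R : realType}.
Implicit Types x y : R[i].

Lemma complexP x y : Re x = Re y -> Im x = Im y -> x = y.
Proof. by case: x y => [a b] [c d] /= -> ->. Qed.

Lemma ReD x y : Re (x + y) = Re x + Re y. Proof. by case: x y => [? ?] []. Qed.
Lemma ImD x y : Im (x + y) = Im x + Im y. Proof. by case: x y => [? ?] []. Qed.
Lemma ReN x : Re (- x) = - Re x. Proof. by case: x. Qed.
Lemma ImN x : Im (- x) = - Im x. Proof. by case: x. Qed.
Lemma ReM x y : Re (x * y) = Re x * Re y - Im x * Im y.
Proof. by case: x y => [? ?] []. Qed.
Lemma ImM x y : Im (x * y) = Re x * Im y + Im x * Re y.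
Proof. by case: x y => [? ?] []. Qed.
Lemma Re_sum (I : Type) (r : seq I) (P : pred I) (F : I -> R[i]) :
  Re (\sum_(i <- r | P i) F i) = \sum_(i <- r | P i) Re (F i).
Proof. exact: (big_morph _ ReD). Qed.
Lemma Im_sum (I : Type) (r : seq I) (P : pred I) (F : I -> R[i]) :
  Im (\sum_(i <- r | P i) F i) = \sum_(i <- r | P i) Im (F i).
Proof. exact: (big_morph _ ImD). Qed.
Lemma ReZ (a : R) x : Re (a%:C * x) = a * Re x.
Proof. by rewrite ReM /= mul0r subr0. Qed.
Lemma ImZ (a : R) x : Im (a%:C * x) = a * Im x.
Proof. by rewrite ImM /= mul0r addr0. Qed.

Lemma normc_ge0 x : 0 <= normc x.
Proof. by case: x => a b; rewrite sqrtr_ge0. Qed.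

Lemma sqr_normc x : normc x ^+ 2 = Re x ^+ 2 + Im x ^+ 2.
Proof. by case: x => a b /=; rewrite sqr_sqrtr// addr_ge0 ?sqr_ge0. Qed.

Lemma normr_Re_le x : `|Re x| <= normc x.
Proof.
by rewrite -(@ler_pXn2r _ 2) ?nnegrE ?normc_ge0// sqr_normc real_normK ?num_real//
  lerDl sqr_ge0.
Qed.

Lemma normr_Im_le x : `|Im x| <= normc x.
Proof.
by rewrite -(@ler_pXn2r _ 2) ?nnegrE ?normc_ge0// sqr_normc real_normK ?num_real//
  lerDr sqr_ge0.
Qed.

Lemma normc_le_parts x : normc x <= `|Re x| + `|Im x|.
Proof.
rewrite -(@ler_pXn2r _ 2) ?nnegrE ?normc_ge0 ?addr_ge0// sqr_normc sqrrD.
rewrite !real_normK ?num_real// lerD2r lerDl mulrn_wge0// mulr_ge0//.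
Qed.

Lemma normc_sum (I : Type) (r : seq I) (P : pred I) (F : I -> R[i]) :
  normc (\sum_(i <- r | P i) F i) <= \sum_(i <- r | P i) normc (F i).
Proof.
elim/big_ind2 : _ => [|x a y b xa yb|//]; first by rewrite ComplexField.Normc.normc0.
by rewrite (le_trans (le_normcD a b))// lerD.
Qed.

Lemma normcE x : `|x| = (normc x)%:C. Proof. by []. Qed.

(** In R[i] a positive number is a positive real, so that balls have real radii
    and the norm can be compared with the absolute values of both parts. *)
Lemma cvg_complexP (T : Type) (F : set_system T) (FF : Filter F) (f : T -> R[i])
    (l : R[i]) :
  f x @[x --> F] --> l <->
  (Re (f x) @[x --> F] --> Re l /\ Im (f x) @[x --> F] --> Im l).
Proof.
split=> [fl|[fr fi]].
  split; apply/cvgrPdist_lt => e e0;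
    (have e0' : (0 : R[i]) < e%:C by rewrite ltcR);
    move/cvgrPdist_lt : fl => /(_ _ e0'); apply: filterS => x;
    rewrite normcE => h; move: (h); rewrite ltcR; apply: le_lt_trans.
  - by rewrite -ReN -ReD normr_Re_le.
  - by rewrite -ImN -ImD normr_Im_le.
apply/cvgrPdist_lt => -[e b]; rewrite ltcE/= => /andP[/eqP -> e0].
near=> x; rewrite normcE -[ltRHS]/(e%:C) ltcR (le_lt_trans (normc_le_parts _))//.
rewrite ReD ReN ImD ImN [ltRHS]splitr ltrD//.
- by near: x; apply: cvgr_dist_lt; [exact: fr|rewrite divr_gt0].
- by near: x; apply: cvgr_dist_lt; [exact: fi|rewrite divr_gt0].
Unshelve. all: by end_near. Qed.

Lemma within_continuous_complexP (A : set R) (f : R -> R[i]) :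
  {within A, continuous f} <->
  ({within A, continuous (Re \o f)} /\
   {within A, continuous (Im \o f)}).
Proof.
split=> [cf|[cr ci] x].
  have cf' (x : subspace A) := (@cvg_complexP _ _ (@nbhs_filter (subspace A) x) f (f x)).1 (cf x).
  by split=> x; [exact: (cf' x).1|exact: (cf' x).2].
apply: (@cvg_complexP _ _ (@nbhs_filter (subspace A) x) f (f x)).2.
by split; [exact: cr|exact: ci].
Qed.

(** The neighbourhoods of a matrix are the entrywise ones; the limit is unique
    because each coordinate is a continuous map into a Hausdorff space. *)
Lemma cvg_mx_lim m n (u : nat -> 'M[R[i]]_(m, n)) (M : 'M[R[i]]_(m, n)) :
  (forall i j, u k i j @[k --> \oo] --> M i j) -> limn u = M.
Proof.
move=> uM.
have uMc : u @ \oo --> M.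
  move=> /= A [P MP PA].
  have uP i j : \forall k \near \oo, P i j (u k i j) by exact: uM (MP i j).
  have uPi i : \forall k \near \oo, forall j, P i j (u k i j).
    exact: filter_forall (uP i).
  have : \forall k \near \oo, forall i j, P i j (u k i j).
    exact: filter_forall uPi.
  by apply: filterS => k; exact: PA.
have ul : u @ \oo --> limn u by apply: cvgP; exact: uMc.
apply/matrixP => i j.
apply: (@cvg_unique _ (@norm_hausdorff _ R[i]) ((fun k => u k i j) @ \oo)).
- exact: (cvg_comp _ _ ul (@coord_continuous _ _ _ i j _)).
- exact: uM.
Qed.

End complex_parts.

(** * Exponential series and derivatives in a real variable *)

Section exponential_series.
Context {R : realType}.
Implicit Types (a : R^nat) (z : nat -> R[i]).

(** The exponential generating function of [a]. Each part of each entry of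
    [expmx (t%:C *: A)] is of this form, and differentiating it shifts [a]. *)
Definition egf a (t : R) : R := limn (pseries (fun k => a k / k`!%:R) t).

(** This growth gives [egf a] an infinite radius of convergence, and is stable
    under the shift. *)
Definition geometric_bound a :=
  exists CN : R * R, [/\ 0 <= CN.1, 0 <= CN.2 & forall k, `|a k| <= CN.1 * CN.2 ^+ k].

Lemma geometric_boundS a : geometric_bound a -> geometric_bound (fun k => a k.+1).
Proof.
move=> [[C N] [/= C0 N0 aCN]]; exists (C * N, N); split => //=.
  by rewrite mulr_ge0.
by move=> k; rewrite (le_trans (aCN _))// exprS mulrA.
Qed.

Lemma is_cvg_egf a t : geometric_bound a -> cvgn (pseries (fun k => a k / k`!%:R) t).
Proof.
move=> [[C N] [/= C0 N0 aCN]]; apply: normed_cvg.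
apply: (@series_le_cvg _ _ (fun k => C * exp_coeff (N * `|t|) k)).
- by move=> n /=.
- by move=> n; rewrite mulr_ge0// /exp_coeff/= divr_ge0// exprn_ge0// mulr_ge0.
- move=> n /=; rewrite /exp_coeff /= !normrM normfV normr_nat normrX exprMn.
  rewrite [leLHS]mulrAC !mulrA ler_wpM2r ?invr_ge0 ?ler0n//.
  by rewrite ler_wpM2r ?exprn_ge0.
- exact: is_cvg_seriesZ (is_cvg_series_exp_coeff _).
Qed.

Lemma pseries_diffs_egf a :
  pseries_diffs (fun k => a k / k`!%:R) = (fun k => a k.+1 / k`!%:R).
Proof.
apply/funext => k; rewrite /pseries_diffs factS natrM invfM.
by rewrite mulrCA mulrA mulrA mulfK// pnatr_eq0.
Qed.

Lemma is_derive_egf a (t : R) : geometric_bound a ->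
  is_derive t (1 : R) (egf a) (egf (fun k => a k.+1) t).
Proof.
move=> ga.
have := @pseries_snd_diffs R (fun k => a k / k`!%:R) (`|t| + 1) t.
rewrite !pseries_diffs_egf; apply.
- exact: is_cvg_egf.
- exact: is_cvg_egf (geometric_boundS ga).
- exact: is_cvg_egf (geometric_boundS (geometric_boundS ga)).
- by rewrite [ltRHS]ger0_norm ?addr_ge0// ltrDl.
Qed.

Definition cgeometric_bound z :=
  exists CN : R * R, [/\ 0 <= CN.1, 0 <= CN.2 & forall k, normc (z k) <= CN.1 * CN.2 ^+ k].

Lemma geometric_bound_Re z : cgeometric_bound z -> geometric_bound (fun k => Re (z k)).
Proof.
move=> [[C N] [C0 N0 h]]; exists (C, N); split => // k.
exact: le_trans (normr_Re_le _) (h k).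
Qed.

Lemma geometric_bound_Im z : cgeometric_bound z -> geometric_bound (fun k => Im (z k)).
Proof.
move=> [[C N] [C0 N0 h]]; exists (C, N); split => // k.
exact: le_trans (normr_Im_le _) (h k).
Qed.

Definition cegf z t : R[i] :=
  egf (fun k => Re (z k)) t +i* egf (fun k => Im (z k)) t.

Lemma cvg_cegf z t : cgeometric_bound z ->
  \sum_(0 <= k < n) ((k`!%:R^-1 * t ^+ k)%:C * z k) @[n --> \oo] --> cegf z t.
Proof.
move=> gz; apply/cvg_complexP; split => /=.
- have -> : (fun n => Re (\sum_(0 <= k < n) ((k`!%:R^-1 * t ^+ k)%:C * z k))) =
            pseries (fun k => Re (z k) / k`!%:R) t.
    apply/funext => n; rewrite /pseries /series /= Re_sum; apply: eq_bigr => k _.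
    by rewrite ReZ mulrC mulrA.
  exact: is_cvg_egf (geometric_bound_Re gz).
- have -> : (fun n => Im (\sum_(0 <= k < n) ((k`!%:R^-1 * t ^+ k)%:C * z k))) =
            pseries (fun k => Im (z k) / k`!%:R) t.
    apply/funext => n; rewrite /pseries /series /= Im_sum; apply: eq_bigr => k _.
    by rewrite ImZ mulrC mulrA.
  exact: is_cvg_egf (geometric_bound_Im gz).
Qed.

End exponential_series.

Section complex_derivative.
Context {R : realType}.
Implicit Types f g : R -> R[i].

(** Differentiation in a real variable: [R[i]] is a normed module over itself
    and not over [R], hence the detour through both parts. *)
Definition cderive f f' := forall t : R,
  is_derive t (1 : R) (fun s => Re (f s)) (Re (f' t)) /\
  is_derive t (1 : R) (fun s => Im (f s)) (Im (f' t)).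

Lemma cderive_ext f g f' : f =1 g -> cderive f f' -> cderive g f'.
Proof. by move=> /funext ->. Qed.

Lemma cderive_cst c : cderive (fun=> c) (fun=> 0).
Proof. by move=> t; split; exact: is_derive_cst. Qed.

Lemma cderiveD f g f' g' : cderive f f' -> cderive g g' ->
  cderive (fun t => f t + g t) (fun t => f' t + g' t).
Proof.
move=> df dg t; have [fr fi] := df t; have [gr gi] := dg t.
split.
- have -> : (fun s => Re (f s + g s)) = (fun s => Re (f s)) \+ (fun s => Re (g s)).
    by apply/funext => s; rewrite ReD.
  by rewrite ReD; exact: is_deriveD.
- have -> : (fun s => Im (f s + g s)) = (fun s => Im (f s)) \+ (fun s => Im (g s)).
    by apply/funext => s; rewrite ImD.
  by rewrite ImD; exact: is_deriveD.
Qed.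

Lemma cderive_sum (I : Type) (r : seq I) (f f' : I -> R -> R[i]) :
  (forall i, cderive (f i) (f' i)) ->
  cderive (fun t => \sum_(i <- r) f i t) (fun t => \sum_(i <- r) f' i t).
Proof.
move=> df; elim: r => [|i r ih].
  have e0 (h : I -> R -> R[i]) : (fun t => \sum_(i <- [::]) h i t) = (fun=> 0).
    by apply/funext => t; rewrite big_nil.
  by rewrite !e0; exact: cderive_cst.
have eS (h : I -> R -> R[i]) : (fun t => \sum_(j <- i :: r) h j t) =
    (fun t => h i t + \sum_(j <- r) h j t).
  by apply/funext => t; rewrite big_cons.
by rewrite !eS; exact: cderiveD.
Qed.

Lemma cderiveM f g f' g' : cderive f f' -> cderive g g' ->
  cderive (fun t => f t * g t) (fun t => f' t * g t + f t * g' t).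
Proof.
move=> df dg t; have [fr fi] := df t; have [gr gi] := dg t.
split.
- have -> : (fun s => Re (f s * g s)) = (fun s => Re (f s)) * (fun s => Re (g s))
     - (fun s => Im (f s)) * (fun s => Im (g s)).
    by apply/funext => s; rewrite ReM.
  apply: is_derive_eq; rewrite ReD !ReM /GRing.scale /=; ring.
- have -> : (fun s => Im (f s * g s)) = (fun s => Re (f s)) * (fun s => Im (g s))
     + (fun s => Im (f s)) * (fun s => Re (g s)).
    by apply/funext => s; rewrite ImM.
  apply: is_derive_eq; rewrite ImD !ImM /GRing.scale /=; ring.
Qed.

Lemma cderive_affine f f' (a b : R) : cderive f f' ->
  cderive (fun t => f (a * t + b)) (fun t => a%:C * f' (a * t + b)).
Proof.
move=> df t; have [fr fi] := df (a * t + b).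
have ab : is_derive t (1:R) (fun s : R => a * s + b) a.
  by apply: is_derive_eq; rewrite /GRing.scale /= mulr1 addr0.
split.
- have := @is_derive1_comp R (fun s => Re (f s)) (fun s => a * s + b) t _ _ fr ab.
  by rewrite ReZ mulrC.
- have := @is_derive1_comp R (fun s => Im (f s)) (fun s => a * s + b) t _ _ fi ab.
  by rewrite ImZ mulrC.
Qed.

Lemma cderive0_cst f : cderive f (fun=> 0) -> forall x y, f x = f y.
Proof.
move=> df x y; apply: complexP.
- by apply: (@is_derive_0_is_cst R (fun s => Re (f s))) => t; exact: (df t).1.
- by apply: (@is_derive_0_is_cst R (fun s => Im (f s))) => t; exact: (df t).2.
Qed.

End complex_derivative.

(** * The matrix exponential *)

Section matrix_derivative.
Context {R : realType}.

Definition mxderive m n (F F' : R -> 'M[R[i]]_(m, n)) :=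
  forall i j, cderive (fun t => F t i j) (fun t => F' t i j).

Lemma mxderiveM m n p (F F' : R -> 'M[R[i]]_(m, n)) (G G' : R -> 'M[R[i]]_(n, p)) :
  mxderive F F' -> mxderive G G' ->
  mxderive (fun t => F t *m G t) (fun t => F' t *m G t + F t *m G' t).
Proof.
move=> dF dG i j.
have -> : (fun t => (F' t *m G t + F t *m G' t) i j) =
    (fun t => \sum_k (F' t i k * G t k j + F t i k * G' t k j)).
  by apply/funext => t; rewrite big_split/= !mxE.
apply: (@cderive_ext _ (fun t => \sum_k F t i k * G t k j)).
  by move=> t; rewrite mxE.
by apply: cderive_sum => k; exact: cderiveM.
Qed.

Lemma mxderive_affine m n (F F' : R -> 'M[R[i]]_(m, n)) (a b : R) : mxderive F F' ->
  mxderive (fun t => F (a * t + b)) (fun t => a%:C *: F' (a * t + b)).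
Proof.
move=> dF i j.
have -> : (fun t => (a%:C *: F' (a * t + b)) i j) =
    (fun t => a%:C * F' (a * t + b) i j).
  by apply/funext => t; rewrite mxE.
exact: (cderive_affine (f := fun s => F s i j) (f' := fun s => F' s i j)).
Qed.

Lemma mxderive0_cst m n (F : R -> 'M[R[i]]_(m, n)) :
  mxderive F (fun=> 0) -> forall x y, F x = F y.
Proof.
move=> dF x y; apply/matrixP => i j.
apply: (@cderive0_cst _ (fun t => F t i j)) => t.
by have := dF i j t; rewrite mxE.
Qed.

End matrix_derivative.

Section matrix_exponential.
Context {R : realType} (d : nat) (A : 'M[R[i]]_d).

(** The sum of the norms of all entries of [A] bounds its row sums, and the
    largest row sum of norms is submultiplicative. *)
Lemma normc_exp_mx : exists2 N : R, 0 <= N &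
  forall k i j, normc ((A ^+ k) i j) <= N ^+ k.
Proof.
pose N := \sum_(i < d) \sum_(j < d) normc (A i j).
have N0 : 0 <= N by do 2 apply: sumr_ge0 => ? _; exact: normc_ge0.
exists N => // k i j.
suff /(le_trans _) : \sum_j normc ((A ^+ k) i j) <= N ^+ k.
  apply; rewrite (bigD1 j)//= lerDl sumr_ge0// => ? _; exact: normc_ge0.
elim: k i {j} => [|k ih] i.
  rewrite !expr0 (bigD1 i)//= mxE eqxx ComplexField.Normc.normc1 big1 ?addr0// => j.
  by rewrite eq_sym => /negbTE ij; rewrite mxE ij ComplexField.Normc.normc0.
have Ni : \sum_j normc (A i j) <= N.
  rewrite /N [leRHS](bigD1 i)//= lerDl; do 2 apply: sumr_ge0 => ? _.
  exact: normc_ge0.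
rewrite exprS [leRHS]exprS.
apply: (@le_trans _ _ (\sum_j \sum_l normc (A i l) * normc ((A ^+ k) l j))).
  apply: ler_sum => j _; rewrite mxE (le_trans (normc_sum _ _ _))//.
  by apply: ler_sum => l _; rewrite ComplexField.Normc.normcM.
rewrite exchange_big/= (@le_trans _ _ (\sum_l normc (A i l) * N ^+ k))//.
  by apply: ler_sum => l _; rewrite -mulr_sumr ler_wpM2l ?normc_ge0.
by rewrite -mulr_suml ler_wpM2r// exprn_ge0.
Qed.

Lemma cgeometric_bound_exp_mx i j : cgeometric_bound (fun k => (A ^+ k) i j).
Proof.
have [N N0 h] := normc_exp_mx.
by exists (1, N); split => //= k; rewrite mul1r.
Qed.

Lemma expr_scalemx (a : R[i]) k : (a *: A) ^+ k = a ^+ k *: A ^+ k.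
Proof.
elim: k => [|k ih]; first by rewrite !expr0 scale1r.
rewrite !exprS ih -[LHS]/((a *: A) *m (a ^+ k *: A ^+ k)).
by rewrite -scalemxAl -scalemxAr scalerA.
Qed.

Lemma expmx_entry t i j : expmx (t%:C *: A) i j = cegf (fun k => (A ^+ k) i j) t.
Proof.
rewrite /expmx (@cvg_mx_lim _ _ _ _ (\matrix_(i, j) cegf (fun k => (A ^+ k) i j) t)).
  by rewrite mxE.
move=> {}i {}j; rewrite mxE.
have := cvg_cegf (t := t) (cgeometric_bound_exp_mx i j).
apply: cvg_trans; apply: near_eq_cvg; near=> n.
rewrite /series /= summxE; apply: eq_bigr => k _.
rewrite expr_scalemx !mxE mulrA; congr (_ * _).
by rewrite rmorphM rmorphXn /= fmorphV/= rmorph_nat.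
Unshelve. all: by end_near. Qed.

Lemma cvg_expmx_sandwich m n (P : 'M[R[i]]_(m, d)) (Q : 'M[R[i]]_(d, n)) t i j :
  \sum_(0 <= k < N) ((k`!%:R^-1 * t ^+ k)%:C * (P *m A ^+ k *m Q) i j) @[N --> \oo]
    --> (P *m expmx (t%:C *: A) *m Q) i j.
Proof.
have -> : (fun N => \sum_(0 <= k < N) ((k`!%:R^-1 * t ^+ k)%:C * (P *m A ^+ k *m Q) i j)) =
    (fun N => \sum_q (\sum_l P i l *
       \sum_(0 <= k < N) (k`!%:R^-1 * t ^+ k)%:C * (A ^+ k) l q) * Q q j).
  apply/funext => N; under [LHS]eq_bigr do rewrite mxE mulr_sumr.
  rewrite exchange_big/=; apply: eq_bigr => q _.
  under [LHS]eq_bigr do rewrite mxE mulrA mulr_sumr.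
  rewrite -mulr_suml exchange_big/=; congr (_ * _); apply: eq_bigr => l _.
  by rewrite mulr_sumr; apply: eq_bigr => k _; rewrite mulrCA.
rewrite mxE; apply: cvg_big => [|q _]; first exact: add_continuous.
apply: cvgM; last exact: cvg_cst.
rewrite mxE; apply: cvg_big => [|l _]; first exact: add_continuous.
rewrite expmx_entry; apply: cvgM; first exact: cvg_cst.
exact: cvg_cegf (cgeometric_bound_exp_mx l q).
Qed.

(** The exponential is a limit of combinations of powers. This is used both for
    commutation with [A] and for the vanishing of C e^(tA) B. *)
Lemma eq_expmx_sandwich m n (P P' : 'M[R[i]]_(m, d)) (Q Q' : 'M[R[i]]_(d, n)) t :
  (forall k, P *m A ^+ k *m Q = P' *m A ^+ k *m Q') ->
  P *m expmx (t%:C *: A) *m Q = P' *m expmx (t%:C *: A) *m Q'.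
Proof.
move=> PQ; apply/matrixP => i j.
have PQc := @cvg_expmx_sandwich _ _ P Q t i j.
apply: (@cvg_unique _ (@norm_hausdorff _ R[i]) _ _ _ _ PQc).
rewrite (_ : (fun N => _) = (fun N => \sum_(0 <= k < N)
    ((k`!%:R^-1 * t ^+ k)%:C * (P' *m A ^+ k *m Q') i j))).
  exact: cvg_expmx_sandwich.
by apply/funext => N; apply: eq_bigr => k _; rewrite PQ.
Qed.

Lemma expmx_comm t : expmx (t%:C *: A) *m A = A *m expmx (t%:C *: A).
Proof.
rewrite -[X in X *m A]mul1mx -[RHS]mulmx1; apply: eq_expmx_sandwich => k.
by rewrite mul1mx mulmx1 -[A *m _]/(A * A ^+ k) -[_ *m A]/(A ^+ k * A) -exprS -exprSr.
Qed.

Lemma mxderive_expmx :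
  mxderive (fun t => expmx (t%:C *: A)) (fun t => A *m expmx (t%:C *: A)).
Proof.
move=> i j t.
have bS : cgeometric_bound (fun k => (A ^+ k.+1) i j).
  have [N N0 h] := normc_exp_mx.
  by exists (N, N); split => //= k; rewrite -exprS.
have -> : (A *m expmx (t%:C *: A)) i j = cegf (fun k => (A ^+ k.+1) i j) t.
  have := @cvg_expmx_sandwich _ _ A 1%:M t i j; rewrite mulmx1 => cAE.
  apply: (@cvg_unique _ (@norm_hausdorff _ R[i]) _ _ _ _ cAE).
  have AS k : A *m A ^+ k *m 1%:M = A ^+ k.+1 by rewrite mulmx1 exprS.
  rewrite (_ : (fun N => _) = (fun N => \sum_(0 <= k < N)
      ((k`!%:R^-1 * t ^+ k)%:C * (A ^+ k.+1) i j))); first exact: cvg_cegf bS.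
  by apply/funext => N; apply: eq_bigr => k _; rewrite AS.
have b := cgeometric_bound_exp_mx i j.
split.
- rewrite (_ : (fun s => _) = egf (fun k => Re ((A ^+ k) i j))); last first.
    by apply/funext => s; rewrite expmx_entry.
  exact: is_derive_egf (geometric_bound_Re b).
- rewrite (_ : (fun s => _) = egf (fun k => Im ((A ^+ k) i j))); last first.
    by apply/funext => s; rewrite expmx_entry.
  exact: is_derive_egf (geometric_bound_Im b).
Qed.

Lemma expmx0 : expmx ((0 : R)%:C *: A) = 1%:M.
Proof.
apply/matrixP => i j; rewrite expmx_entry.
apply: (@cvg_unique _ (@norm_hausdorff _ R[i]) _ _ _ _ (cvg_cegf (t := 0) (cgeometric_bound_exp_mx i j))).
apply: cvg_near_cst; near=> n.
have n0 : (0 < n)%N by near: n; exists 1%N.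
rewrite big_ltn// big_nat big1 => [|k /andP[k0 _]]; last first.
  by rewrite expr0n eqn0Ngt k0/= mulr0 mul0r.
by rewrite addr0 !expr0 fact0 invr1 mulr1 mul1r.
Unshelve. all: by end_near. Qed.

Lemma mxderive_expmx_rev t :
  mxderive (fun s => expmx ((t - s)%:C *: A)) (fun s => - A *m expmx ((t - s)%:C *: A)).
Proof.
have ts s : -1 * s + t = t - s by rewrite mulN1r addrC.
have -> : (fun s => expmx ((t - s)%:C *: A)) = (fun s => expmx ((-1 * s + t)%:C *: A)).
  by apply/funext => s; rewrite ts.
have -> : (fun s => - A *m expmx ((t - s)%:C *: A)) =
    (fun s => (-1)%:C *: (A *m expmx ((-1 * s + t)%:C *: A))).
  by apply/funext => s; rewrite ts rmorphN rmorph1 scaleN1r mulNmx.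
exact: mxderive_affine mxderive_expmx.
Qed.

(** The derivative of the product vanishes, as [A] commutes with its
    exponential. *)
Lemma expmx_inv t : expmx (t%:C *: A) *m expmx ((- t)%:C *: A) = 1%:M.
Proof.
pose E (s : R) := expmx (s%:C *: A).
have dEN : mxderive (fun s => E (- s)) (fun s => - A *m E (- s)).
  have -> : (fun s => E (- s)) = (fun s => expmx ((0 - s)%:C *: A)).
    by apply/funext => s; rewrite sub0r.
  have -> : (fun s => - A *m E (- s)) = (fun s => - A *m expmx ((0 - s)%:C *: A)).
    by apply/funext => s; rewrite sub0r.
  exact: mxderive_expmx_rev.
have dEE : mxderive (fun s => E s *m E (- s)) (fun=> 0).
  have -> : (fun=> 0) = (fun s : R => A *m E s *m E (- s) + E s *m (- A *m E (- s))).
    by apply/funext => s; rewrite mulNmx mulmxN mulmxA expmx_comm subrr.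
  exact: mxderiveM mxderive_expmx dEN.
by rewrite (mxderive0_cst dEE t 0) oppr0 /E expmx0 mulmx1.
Qed.

End matrix_exponential.

(** * Integration by parts against a primitive *)

Section real_integrals.
Context {R : realType}.
Local Notation mu := (@lebesgue_measure R).
Implicit Types (f g h psi : R -> R).

Definition rintegrable (E : set R) f := mu.-integrable E (EFin \o f).

Lemma rintegrable_measurable E f : rintegrable E f -> measurable_fun E f.
Proof. by move=> fE; apply/measurable_EFinP; exact: (measurable_int mu). Qed.

Lemma rintegrable_patch (E : set R) f : measurable E ->
  rintegrable E f -> rintegrable setT (f \_ E).
Proof.
move=> mE fE; rewrite /rintegrable -restrict_EFin.
exact/(integrable_mkcond (mu := mu) (EFin \o f) mE).
Qed.

Lemma rintegrable_itvS (a b s t : R) f : a <= s -> t <= b ->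
  rintegrable `[a, b] f -> rintegrable `[s, t] f.
Proof.
move=> as_ tb; apply: integrableS => //.
by apply: subset_itv; rewrite bnd_simp.
Qed.

Lemma continuous_rintegrable (a b : R) f :
  {within `[a, b], continuous f} -> rintegrable `[a, b] f.
Proof. by apply: continuous_compact_integrable; exact: segment_compact. Qed.

Lemma rintegrableMl (a b : R) psi f :
  {within `[a, b], continuous psi} -> rintegrable `[a, b] f ->
  rintegrable `[a, b] (fun x => psi x * f x).
Proof.
move=> cpsi fint.
have mpsi : measurable_fun `[a, b] psi.
  exact: rintegrable_measurable (continuous_rintegrable cpsi).
have bpsi : [bounded psi x | x in `[a, b]].
  have /compact_bounded : compact (psi @` `[a, b]).
    by apply: continuous_compact => //; exact: segment_compact.
  move=> [M [Mr MP]]; exists M; split => // x Mx y aby.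
  by apply: (MP x Mx); exists y.
have := integrableMr (mu := mu) (measurable_itv `[a, b]) mpsi bpsi fint.
by [].
Qed.

Lemma derive_within_continuous (a b : R) psi psi' :
  (forall x : R, is_derive x (1 : R) psi (psi' x)) -> {within `[a, b], continuous psi}.
Proof.
move=> dpsi; apply: derivable_within_continuous => x _.
exact: (@ex_derive _ _ _ _ _ _ _ (dpsi x)).
Qed.

Lemma Rintegral_derive (a b : R) psi psi' : a <= b ->
  (forall x : R, is_derive x (1 : R) psi (psi' x)) ->
  {within `[a, b], continuous psi'} ->
  \int[mu]_(x in `[a, b]) psi' x = psi b - psi a.
Proof.
rewrite le_eqVlt => /predU1P[<- _ _|ab dpsi cpsi'].
  by rewrite set_itv1 Rintegral_set1 subrr.
have cpsi : continuous psi.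
  move=> x; apply/differentiable_continuous/derivable1_diffP.
  exact: (@ex_derive _ _ _ _ _ _ _ (dpsi x)).
rewrite /Rintegral (@continuous_FTC2 _ psi' psi a b)//.
  split.
  - by move=> x _; exact: (@ex_derive _ _ _ _ _ _ _ (dpsi x)).
  - exact/cvg_at_right_filter/cpsi.
  - exact/cvg_at_left_filter/cpsi.
by move=> x _; rewrite derive1E; exact: (@derive_val _ _ _ _ _ _ _ (dpsi x)).
Qed.

(** Integration by parts when one factor is the primitive of a merely integrable
    [h], hence not differentiable everywhere: this is Fubini on the triangle
    0 <= r <= s <= t, where the inner integral of [psi'] over [r, t] is
    [psi t - psi r]. *)
Lemma Rintegral_by_parts_primitive (t : R) h psi psi' :
  rintegrable `[0, t] h ->
  (forall x : R, is_derive x (1 : R) psi (psi' x)) ->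
  {within `[0, t], continuous psi'} ->
  \int[mu]_(s in `[0, t]) (psi' s * \int[mu]_(r in `[0, s]) h r) =
  psi t * (\int[mu]_(r in `[0, t]) h r) - \int[mu]_(r in `[0, t]) (psi r * h r).
Proof.
move=> hint dpsi cpsi'.
(* The measurable type that carries [mu], needed to form [mu \x mu]. *)
pose T := measurableTypeR R.
have mI : measurable (`[0, t] : set R) by [].
pose H := h \_ `[0, t]; pose P := psi' \_ `[0, t].
have Hint : rintegrable setT H by exact: rintegrable_patch.
have Pint : rintegrable setT P.
  by apply: rintegrable_patch => //; exact: continuous_rintegrable.
have mH : measurable_fun setT H by exact: rintegrable_measurable.
have mP : measurable_fun setT P by exact: rintegrable_measurable.
(* The indicator of the triangle. *)
pose D (s r : R) : R := (r <= s)%R%:R.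
have mD : measurable_fun setT (fun z : T * T => D z.1 z.2).
  rewrite (_ : (fun z => _) = \1_[set z : T * T | (z.2 <= z.1)%R]); last first.
    by apply/funext => z; rewrite indicE mem_setE.
  apply/measurable_indic.
  have : measurable_fun setT (fun z : T * T => (z.2 <= z.1)%R).
    exact: measurable_fun_ler.
  by move=> /(_ measurableT [set true]); rewrite setTI; exact.
pose f (z : T * T) : \bar R := (P z.1 * (H z.2 * D z.1 z.2))%:E.
have mf : measurable_fun setT f.
  apply/measurable_EFinP; apply: measurable_funM.
    exact: (measurableT_comp mP measurable_fst).
  by apply: measurable_funM => //; exact: (measurableT_comp mH measurable_snd).
have D01 s r : 0 <= D s r <= 1 by rewrite /D; case: (r <= s); rewrite ?ler01 ?lexx.
have fint : (mu \x mu)%E.-integrable setT f.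
  apply/integrable12ltyP => //.
  pose J := (\int[mu]_r `|(H r)%:E|)%E.
  have Jfin : J \is a fin_num.
    rewrite ge0_fin_numE; last exact: integral_ge0.
    by have /integrableP[] := Hint.
  apply: (@le_lt_trans _ _ (\int[mu]_s (J * `|(P s)%:E|)))%E.
    apply: ge0_le_integral => //.
    - by move=> s _; exact: integral_ge0.
    - have maf : measurable_fun [set: T * T] (abse \o f) by apply: measurableT_comp.
      apply: (@measurable_fun_fubini_tonelli_F _ _ T T R mu (abse \o f) maf) => z.
      exact: abse_ge0.
    - apply: measurable_funeM; apply: measurableT_comp => //.
      exact/measurable_EFinP.
    - move=> s _; rewrite muleC -ge0_integralZl//; last first.
        by apply: measurableT_comp => //; exact/measurable_EFinP.
      apply: ge0_le_integral => //.
      + apply: measurableT_comp => //.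
        exact: (measurableT_comp mf (pair1_measurable s)).
      + apply: measurable_funeM; apply: measurableT_comp => //.
        exact/measurable_EFinP.
      + move=> r _; rewrite -abseM -EFinM !abse_EFin lee_fin !normrM.
        rewrite ler_wpM2l// ler_piMr// ger0_norm; by case/andP: (D01 s r).
  rewrite ge0_integralZl//; last 2 first.
    by apply: measurableT_comp => //; exact/measurable_EFinP.
    exact: integral_ge0.
  rewrite lte_mul_pinfty//; first exact: integral_ge0.
  by have /integrableP[] := Pint.
have := Fubini fint.
have inner1 s : (\int[mu]_r f (s, r))%E =
    ((fun s => psi' s * \int[mu]_(r in `[0, s]) h r) \_ `[0, t] s)%:E.
  rewrite patchE; case: ifPn => sI; last first.
    by apply: integral0_eq => r _; rewrite /f /= /P patchE (negbTE sI) mul0r.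
  have /andP[s0 st] : 0 <= s <= t by move: sI; rewrite inE/= in_itv.
  have hs : rintegrable setT (h \_ `[0, s]).
    by apply: rintegrable_patch => //; exact: rintegrable_itvS hint.
  rewrite EFinM Rintegral_mkcond /Rintegral fineK; last exact: integrable_fin_num hs.
  rewrite -integralZl//; apply: eq_integral => r _.
  rewrite -EFinM /f /= /P patchE sI /H !patchE /D !mem_setE; congr (_ * _)%:E.
  rewrite !in_itv/=; case: (leP 0 r) => r0 /=; last by rewrite mul0r.
  have [rs|sr] := leP r s; first by rewrite (le_trans rs st) mulr1.
  by rewrite mulr0.
have inner2 r : (\int[mu]_s f (s, r))%E =
    ((fun r => psi t * h r - psi r * h r) \_ `[0, t] r)%:E.
  rewrite patchE; case: ifPn => rI; last first.
    apply: integral0_eq => s _.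
    by rewrite /f /= /H patchE (negbTE rI) mul0r mulr0.
  have /andP[r0 rt] : 0 <= r <= t by move: rI; rewrite inE/= in_itv.
  have cpsi'r : {within `[r, t], continuous psi'}.
    apply: continuous_subspaceW cpsi'.
    by apply: subset_itvr; rewrite bnd_simp.
  have ps : rintegrable setT (psi' \_ `[r, t]).
    by apply: rintegrable_patch => //; exact: continuous_rintegrable.
  rewrite -mulrBl mulrC -(Rintegral_derive rt dpsi cpsi'r) Rintegral_mkcond.
  rewrite EFinM /Rintegral fineK; last exact: integrable_fin_num ps.
  rewrite -integralZl//; apply: eq_integral => s _.
  rewrite -EFinM /f /= /H patchE rI mulrCA; congr (_ * _)%:E.
  rewrite /P !patchE /D !mem_setE !in_itv/=.
  have [rs|sr] /= := leP r s; last by rewrite mulr0.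
  by rewrite (le_trans r0 rs) mulr1.
under eq_integral do rewrite inner1.
under [RHS]eq_integral do rewrite inner2.
move=> /(congr1 fine); rewrite -!/(Rintegral _ _ _) -!Rintegral_mkcond => ->.
rewrite RintegralB//.
- by rewrite RintegralZl.
- apply: rintegrableMl => //; exact: cst_continuous.
- by apply: rintegrableMl => //; exact: derive_within_continuous dpsi.
Qed.

End real_integrals.

(** * Integrals of complex functions *)

Section complex_integrals.
Context {R : realType}.
Local Notation mu := (@lebesgue_measure R).
Implicit Types (f g h psi : R -> R[i]) (E : set R).

Definition cintegrable E f :=
  rintegrable E (fun x => Re (f x)) /\ rintegrable E (fun x => Im (f x)).

Lemma eq_rintegrable E (f g : R -> R) : {in E, f =1 g} ->
  measurable E -> rintegrable E f -> rintegrable E g.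
Proof.
move=> fg mE; apply: eq_integrable => // x xE.
by rewrite /= fg.
Qed.

Lemma rintegrableD E (f g : R -> R) : measurable E ->
  rintegrable E f -> rintegrable E g -> rintegrable E (fun x => f x + g x).
Proof. by move=> mE fi gi; have := integrableD (mu := mu) mE fi gi. Qed.

Lemma rintegrableZ E (f : R -> R) (c : R) : measurable E ->
  rintegrable E f -> rintegrable E (fun x => c * f x).
Proof. by move=> mE fi; have := integrableZl (mu := mu) mE c fi. Qed.

Lemma rintegrableB E (f g : R -> R) : measurable E ->
  rintegrable E f -> rintegrable E g -> rintegrable E (fun x => f x - g x).
Proof. by move=> mE fi gi; have := integrableB (mu := mu) mE fi gi. Qed.

Lemma eq_cintegral E f g : {in E, f =1 g} -> cintegral E f = cintegral E g.
Proof.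
move=> fg; congr (_ +i* _); apply: eq_Rintegral => x xE; by rewrite fg.
Qed.

Lemma cintegrable0 E : cintegrable E (fun=> 0).
Proof. by split; exact: integrable0. Qed.

Lemma cintegrableD E f g : measurable E ->
  cintegrable E f -> cintegrable E g -> cintegrable E (fun x => f x + g x).
Proof.
move=> mE [fr fi] [gr gi]; split.
- by under [X in rintegrable _ X]eq_fun do rewrite ReD; exact: rintegrableD.
- by under [X in rintegrable _ X]eq_fun do rewrite ImD; exact: rintegrableD.
Qed.

Lemma cintegrableZ E f (c : R[i]) : measurable E ->
  cintegrable E f -> cintegrable E (fun x => c * f x).
Proof.
move=> mE [fr fi]; split.
- under [X in rintegrable _ X]eq_fun do rewrite ReM.
  by apply: rintegrableB => //; exact: rintegrableZ.
- under [X in rintegrable _ X]eq_fun do rewrite ImM.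
  by apply: rintegrableD => //; exact: rintegrableZ.
Qed.

Lemma cintegrable_sum E (I : Type) (r : seq I) (f : I -> R -> R[i]) : measurable E ->
  (forall i, cintegrable E (f i)) -> cintegrable E (fun x => \sum_(i <- r) f i x).
Proof.
move=> mE fi; elim: r => [|i r ih].
  by under eq_fun do rewrite big_nil; exact: cintegrable0.
by under eq_fun do rewrite big_cons; exact: cintegrableD.
Qed.

Lemma cintegral0 E : cintegral E (fun=> 0) = 0.
Proof. by rewrite /cintegral /= /Rintegral integral0. Qed.

Lemma cintegralD E f g : measurable E -> cintegrable E f -> cintegrable E g ->
  cintegral E (fun x => f x + g x) = cintegral E f + cintegral E g.
Proof.
move=> mE [fr fi] [gr gi]; apply: complexP; rewrite ?ReD ?ImD /=.
- by rewrite -RintegralD//; apply: eq_Rintegral => x _; rewrite ReD.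
- by rewrite -RintegralD//; apply: eq_Rintegral => x _; rewrite ImD.
Qed.

Lemma cintegralZ E f (c : R[i]) : measurable E -> cintegrable E f ->
  cintegral E (fun x => c * f x) = c * cintegral E f.
Proof.
move=> mE [fr fi]; apply: complexP; rewrite ?ReM ?ImM /=.
- rewrite -!RintegralZl// -RintegralB//; try exact: rintegrableZ.
  by apply: eq_Rintegral => x _; rewrite ReM.
- rewrite -!RintegralZl// -RintegralD//; try exact: rintegrableZ.
  by apply: eq_Rintegral => x _; rewrite ImM.
Qed.

Lemma cintegral_sum E (I : Type) (r : seq I) (f : I -> R -> R[i]) : measurable E ->
  (forall i, cintegrable E (f i)) ->
  cintegral E (fun x => \sum_(i <- r) f i x) = \sum_(i <- r) cintegral E (f i).
Proof.
move=> mE fi; elim: r => [|i r ih].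
  rewrite big_nil; under eq_cintegral do rewrite big_nil; exact: cintegral0.
rewrite big_cons -ih -cintegralD//; last exact: cintegrable_sum.
by apply: eq_cintegral => x _; rewrite big_cons.
Qed.

Lemma cintegrable_itvS (a b s t : R) f : a <= s -> t <= b ->
  cintegrable `[a, b] f -> cintegrable `[s, t] f.
Proof. by move=> as_ tb [fr fi]; split; [exact: rintegrable_itvS fr|exact: rintegrable_itvS fi]. Qed.

Lemma continuous_cintegrable (a b : R) f :
  {within `[a, b], continuous f} -> cintegrable `[a, b] f.
Proof.
by move=> /within_continuous_complexP[fr fi]; split; exact: continuous_rintegrable.
Qed.

Lemma cintegrableMl (a b : R) psi f :
  {within `[a, b], continuous psi} -> cintegrable `[a, b] f ->
  cintegrable `[a, b] (fun x => psi x * f x).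
Proof.
move=> /within_continuous_complexP[pr pi] [fr fi]; split.
- under [X in rintegrable _ X]eq_fun do rewrite ReM.
  apply: rintegrableB => //.
    exact: (rintegrableMl (psi := fun x => Re (psi x))).
  exact: (rintegrableMl (psi := fun x => Im (psi x))).
- under [X in rintegrable _ X]eq_fun do rewrite ImM.
  apply: rintegrableD => //.
    exact: (rintegrableMl (psi := fun x => Re (psi x))).
  exact: (rintegrableMl (psi := fun x => Im (psi x))).
Qed.

Lemma cderive_within_continuous (A : set R) psi psi' :
  cderive psi psi' -> {within A, continuous psi}.
Proof.
move=> dpsi; apply: continuous_subspaceT => x; apply/cvg_complexP.
by split; apply/differentiable_continuous/derivable1_diffP;
  [exact: (@ex_derive _ _ _ _ _ _ _ (dpsi x).1)
  |exact: (@ex_derive _ _ _ _ _ _ _ (dpsi x).2)].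
Qed.

Definition cprimitive f (t : R) : R[i] := cintegral `[0, t] f.

Lemma cprimitive_continuous (t : R) f : 0 <= t -> cintegrable `[0, t] f ->
  {within `[0, t], continuous (cprimitive f)}.
Proof.
move=> t0 [fr fi]; apply/within_continuous_complexP; split.
- exact: parameterized_integral_continuous t0 fr.
- exact: parameterized_integral_continuous t0 fi.
Qed.

Lemma cintegral_by_parts_primitive (t : R) h psi psi' : 0 <= t ->
  cintegrable `[0, t] h -> cderive psi psi' -> {within `[0, t], continuous psi'} ->
  cintegral `[0, t] (fun s => psi' s * cprimitive h s) =
  psi t * cprimitive h t - cintegral `[0, t] (fun s => psi s * h s).
Proof.
move=> t0 hi dpsi cpsi'.
have /within_continuous_complexP[cpr cpi] := cpsi'.
have dr x := (dpsi x).1; have di x := (dpsi x).2.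
have /within_continuous_complexP[pr pi] := cderive_within_continuous (A := `[0, t]) dpsi.
have /within_continuous_complexP[Hr Hi] := cprimitive_continuous t0 hi.
have [hr hii] := hi.
have hHr := continuous_rintegrable Hr; have hHi := continuous_rintegrable Hi.
apply: complexP; rewrite ?(ReD, ImD, ReN, ImN, ReM, ImM) /=.
- under eq_Rintegral do rewrite ReM.
  under [X in _ = _ - X]eq_Rintegral do rewrite ReM.
  rewrite !RintegralB//; try by [exact: (rintegrableMl (psi := fun x => Re (psi x)))|
    exact: (rintegrableMl (psi := fun x => Im (psi x)))|
    exact: (rintegrableMl (psi := fun x => Re (psi' x)))|
    exact: (rintegrableMl (psi := fun x => Im (psi' x)))].
  rewrite (Rintegral_by_parts_primitive hr dr cpr).
  rewrite (Rintegral_by_parts_primitive hii di cpi); ring.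
- under eq_Rintegral do rewrite ImM.
  under [X in _ = _ - X]eq_Rintegral do rewrite ImM.
  rewrite !RintegralD//; try by [exact: (rintegrableMl (psi := fun x => Re (psi x)))|
    exact: (rintegrableMl (psi := fun x => Im (psi x)))|
    exact: (rintegrableMl (psi := fun x => Re (psi' x)))|
    exact: (rintegrableMl (psi := fun x => Im (psi' x)))].
  rewrite (Rintegral_by_parts_primitive hii dr cpr).
  rewrite (Rintegral_by_parts_primitive hr di cpi); ring.
Qed.

End complex_integrals.

(** * Integrals of matrices and the state equation *)

Section matrix_integrals.
Context {R : realType}.

Definition mxintegrable m n (t : R) (F : R -> 'M[R[i]]_(m, n)) :=
  forall i j, cintegrable `[0, t] (fun s => F s i j).

Definition mxcontinuous m n (t : R) (F : R -> 'M[R[i]]_(m, n)) :=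
  forall i j, {within `[0, t], continuous (fun s => F s i j)}.

Definition mxprimitive m n (F : R -> 'M[R[i]]_(m, n)) (t : R) : 'M[R[i]]_(m, n) :=
  \matrix_(i, j) cprimitive (fun s => F s i j) t.

Lemma eq_mxprimitive m n (t : R) (F G : R -> 'M[R[i]]_(m, n)) :
  (forall s, 0 <= s <= t -> F s = G s) -> mxprimitive F t = mxprimitive G t.
Proof.
move=> FG; apply/matrixP => i j; rewrite !mxE; apply: eq_cintegral => s.
by rewrite inE/= in_itv/= => /FG ->.
Qed.

Lemma mxintegrableW m n (s t : R) (F : R -> 'M[R[i]]_(m, n)) : s <= t ->
  mxintegrable t F -> mxintegrable s F.
Proof. by move=> st Fi i j; exact: cintegrable_itvS (Fi i j). Qed.

Lemma mxcontinuousW m n (s t : R) (F : R -> 'M[R[i]]_(m, n)) : s <= t ->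
  mxcontinuous t F -> mxcontinuous s F.
Proof.
move=> st Fc i j; apply: continuous_subspaceW (Fc i j).
by apply: subset_itvl; rewrite bnd_simp.
Qed.

Lemma mxcontinuous_integrable m n (t : R) (F : R -> 'M[R[i]]_(m, n)) :
  mxcontinuous t F -> mxintegrable t F.
Proof. by move=> cF i j; exact: continuous_cintegrable. Qed.

Lemma mxderive_continuous m n (t : R) (F F' : R -> 'M[R[i]]_(m, n)) :
  mxderive F F' -> mxcontinuous t F.
Proof. by move=> dF i j; exact: cderive_within_continuous (dF i j). Qed.

Lemma mxcontinuous_cst m n (t : R) (M : 'M[R[i]]_(m, n)) : mxcontinuous t (fun=> M).
Proof. by move=> i j; apply: continuous_subspaceT; exact: cst_continuous. Qed.

Lemma mxcontinuousM m n p (t : R) (F : R -> 'M[R[i]]_(m, n)) (G : R -> 'M[R[i]]_(n, p)) :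
  mxcontinuous t F -> mxcontinuous t G -> mxcontinuous t (fun s => F s *m G s).
Proof.
move=> cF cG i j.
have -> : (fun s => (F s *m G s) i j) = (fun s => \sum_k F s i k * G s k j).
  by apply/funext => s; rewrite mxE.
move=> x; have fx := @nbhs_filter (subspace `[0, t]) x.
apply: (@cvg_big _ _ _ _ _ _ _ _ _ (fun k s => F s i k * G s k j)).
  exact: add_continuous.
by move=> k _; apply: cvgM; [exact: cF|exact: cG].
Qed.

Lemma mxintegrableM m n p (t : R) (F : R -> 'M[R[i]]_(m, n)) (G : R -> 'M[R[i]]_(n, p)) :
  mxcontinuous t F -> mxintegrable t G -> mxintegrable t (fun s => F s *m G s).
Proof.
move=> cF iG i j.
have -> : (fun s => (F s *m G s) i j) = (fun s => \sum_k F s i k * G s k j).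
  by apply/funext => s; rewrite mxE.
apply: cintegrable_sum => // k.
exact: (cintegrableMl (psi := fun s => F s i k)).
Qed.

Lemma mxintegrableD m n (t : R) (F G : R -> 'M[R[i]]_(m, n)) :
  mxintegrable t F -> mxintegrable t G -> mxintegrable t (fun s => F s + G s).
Proof.
move=> iF iG i j; under [X in cintegrable _ X]eq_fun do rewrite mxE.
exact: cintegrableD.
Qed.

Lemma mxprimitiveD m n (t : R) (F G : R -> 'M[R[i]]_(m, n)) :
  mxintegrable t F -> mxintegrable t G ->
  mxprimitive (fun s => F s + G s) t = mxprimitive F t + mxprimitive G t.
Proof.
move=> iF iG; apply/matrixP => i j; rewrite !mxE -[RHS]cintegralD//.
by apply: eq_cintegral => s _; rewrite mxE.
Qed.

Lemma mxprimitive_mulmxl m n p (t : R) (M : 'M[R[i]]_(m, n)) (F : R -> 'M[R[i]]_(n, p)) :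
  mxintegrable t F ->
  mxprimitive (fun s => M *m F s) t = M *m mxprimitive F t.
Proof.
move=> iF; apply/matrixP => i j; rewrite !mxE.
under eq_bigr do rewrite mxE /cprimitive -cintegralZ//.
rewrite -cintegral_sum//; last by move=> k; exact: cintegrableZ.
by apply: eq_cintegral => s _; rewrite mxE.
Qed.

Lemma mxprimitive_continuous m n (t : R) (F : R -> 'M[R[i]]_(m, n)) : 0 <= t ->
  mxintegrable t F -> mxcontinuous t (mxprimitive F).
Proof.
move=> t0 iF i j.
rewrite (_ : (fun s => mxprimitive F s i j) = cprimitive (fun s => F s i j)).
  exact: cprimitive_continuous.
by apply/funext => s; rewrite mxE.
Qed.

Lemma mxprimitive_by_parts m n p (t : R) (Psi Psi' : R -> 'M[R[i]]_(m, n))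
    (H : R -> 'M[R[i]]_(n, p)) : 0 <= t ->
  mxintegrable t H -> mxderive Psi Psi' -> mxcontinuous t Psi' ->
  mxprimitive (fun s => Psi' s *m mxprimitive H s) t =
  Psi t *m mxprimitive H t - mxprimitive (fun s => Psi s *m H s) t.
Proof.
move=> t0 iH dPsi cPsi'; apply/matrixP => i j; rewrite !mxE.
have cPsi := mxderive_continuous (t := t) dPsi.
have cH := mxprimitive_continuous t0 iH.
transitivity (\sum_k (Psi t i k * cprimitive (fun s => H s k j) t -
    cintegral `[0, t] (fun s => Psi s i k * H s k j))); last first.
  rewrite sumrB; congr (_ - _); first by apply: eq_bigr => k _; rewrite mxE.
  rewrite -cintegral_sum//; last first.
    by move=> k; exact: (cintegrableMl (psi := fun s => Psi s i k)).
  by apply: eq_cintegral => s _; rewrite mxE.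
transitivity (\sum_k cintegral `[0, t] (fun s => Psi' s i k *
    cprimitive (fun s => H s k j) s)); last first.
  apply: eq_bigr => k _.
  exact: (cintegral_by_parts_primitive t0 (iH k j) (dPsi i k)).
rewrite -cintegral_sum//; last first.
  move=> k; apply: (cintegrableMl (psi := fun s => Psi' s i k)) => //.
  exact/continuous_cintegrable/cprimitive_continuous.
by apply: eq_cintegral => s _; rewrite mxE; apply: eq_bigr => k _; rewrite mxE.
Qed.

End matrix_integrals.

Section state_space.
Context {R : realType} (d n : nat).
Implicit Types (A : 'M[R[i]]_d) (x f : R -> 'M[R[i]]_(d, n)).

(** The variation-of-constants integral, in the form it takes in [io_map]. *)
Definition duhamel A f (t : R) : 'M[R[i]]_(d, n) :=
  mxprimitive (fun s => expmx ((t - s)%:C *: A) *m f s) t.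

(** The initial value problem x' = A x + f, x(0) = 0 on [0, T]. For integrable
    [f] it is only solved almost everywhere, hence the integrated form. *)
Definition solution A f (T : R) x :=
  mxcontinuous T x /\
  forall t, 0 <= t <= T -> x t = mxprimitive (fun s => A *m x s + f s) t.

(** Uniqueness: if x is the primitive of g = A x + f, integrating by parts
    against s |-> e^((t - s) A), whose derivative is - A e^((t - s) A), makes the
    terms in A x cancel and leaves Duhamel's formula. *)
Lemma solution_duhamel A f (T t : R) x : mxintegrable T f -> solution A f T x ->
  0 <= t <= T -> x t = duhamel A f t.
Proof.
move=> iF [xc xE] /andP[t0 tT].
pose g s := A *m x s + f s.
have ft : mxintegrable t f by exact: mxintegrableW iF.
have xt : mxcontinuous t x by exact: mxcontinuousW xc.
have gt : mxintegrable t g.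
  apply: mxintegrableD => //; apply: mxintegrableM; first exact: mxcontinuous_cst.
  exact: mxcontinuous_integrable.
pose E s := expmx ((t - s)%:C *: A).
have dE : mxderive E (fun s => - A *m E s) := mxderive_expmx_rev A t.
have cE : mxcontinuous t E by exact: mxderive_continuous dE.
have cE' : mxcontinuous t (fun s => - A *m E s).
  exact: mxcontinuousM (@mxcontinuous_cst _ _ _ t (- A)) cE.
have E1 : E t = 1%:M by rewrite /E subrr expmx0.
have EA s : E s *m A = A *m E s by exact: expmx_comm.
have gE s : 0 <= s <= t -> mxprimitive g s = x s.
  by move=> /andP[s0 st]; rewrite -xE// s0 (le_trans st).
have := mxprimitive_by_parts t0 gt dE cE'.
rewrite gE ?t0 ?lexx// E1 mul1mx.
move=> /eqP; rewrite eq_sym subr_eq => /eqP ->.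
rewrite -mxprimitiveD; last 2 first.
- by apply: mxintegrableM => //; exact/mxcontinuous_integrable/mxprimitive_continuous.
- exact: mxintegrableM.
apply: eq_mxprimitive => s st; rewrite gE//.
by rewrite /g !mulNmx mulmxDr [E s *m (_ *m _)]mulmxA EA addKr.
Qed.

(** Existence: integrating by parts shows that e^(t A) times the primitive of
    e^(- s A) f(s) is a solution, as e^(s A) e^(- s A) = 1, and by uniqueness it is
    the Duhamel integral. *)
Lemma duhamel_solution A f (T : R) : 0 <= T -> mxintegrable T f ->
  solution A f T (duhamel A f).
Proof.
move=> T0 iF.
pose E (s : R) := expmx (s%:C *: A).
have dE := mxderive_expmx A.
have cE t : mxcontinuous t E := mxderive_continuous (t := t) dE.
pose F s := E (- s) *m f s.
have cEN : mxcontinuous T (fun s => E (- s)).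
  have -> : (fun s => E (- s)) = (fun s => expmx ((0 - s)%:C *: A)).
    by apply/funext => s; rewrite sub0r.
  exact: mxderive_continuous (mxderive_expmx_rev A 0).
have iEf : mxintegrable T F by exact: mxintegrableM cEN iF.
pose x (t : R) := E t *m mxprimitive F t.
have xs : solution A f T x.
  split; first exact: mxcontinuousM (cE T) (mxprimitive_continuous T0 iEf).
  move=> t /andP[t0 tT].
  have Ft : mxintegrable t F by exact: mxintegrableW iEf.
  have cE' : mxcontinuous t (fun t => A *m E t).
    exact: mxcontinuousM (@mxcontinuous_cst _ _ _ t A) (cE t).
  have ibp : mxprimitive (fun s => A *m E s *m mxprimitive F s) t =
      x t - mxprimitive (fun s => E s *m F s) t := mxprimitive_by_parts t0 Ft dE cE'.
  have iAE : mxintegrable t (fun s => A *m E s *m mxprimitive F s).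
    exact: mxintegrableM cE' (mxcontinuous_integrable (mxprimitive_continuous t0 Ft)).
  have iEF : mxintegrable t (fun s => E s *m F s) by exact: mxintegrableM (cE t) Ft.
  rewrite -[LHS](subrK (mxprimitive (fun s => E s *m F s) t)) -ibp -mxprimitiveD//.
  apply: eq_mxprimitive => s _.
  have EE : E s *m E (- s) = 1%:M by exact: expmx_inv.
  by rewrite -mulmxA -/(x s) [in X in _ + X]/F mulmxA EE mul1mx.
have xD t : 0 <= t <= T -> x t = duhamel A f t by exact: solution_duhamel.
case: xs => xc xE; split.
  move=> i j; apply: subspace_eq_continuous (xc i j) => t.
  by rewrite inE/= in_itv/= /from_subspace => /xD ->.
move=> t tT; rewrite -(xD t tT) (xE t tT); apply: eq_mxprimitive => s /andP[s0 st].
have sT : 0 <= s <= T by rewrite s0 (le_trans st)//; case/andP: tT.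
by rewrite (xD s sT).
Qed.

End state_space.

(** * Square-integrable functions *)

Section square_integrability.
Context {R : realType}.
Local Notation mu := (@lebesgue_measure R).
Implicit Types (tau : R) (f g : R -> R).

Lemma rintegrable_oo_cc (a b : R) f : rintegrable `]a, b[ f -> rintegrable `[a, b] f.
Proof.
move=> /integrableP[mf ioo].
have mo : measurable_fun `]a, b] (EFin \o f).
  by apply/emeasurable_fun_itv_bndo_bndcP.
have mc : measurable_fun `[a, b] (EFin \o f).
  by apply/emeasurable_fun_itv_obnd_cbndP.
apply/integrableP; split => //.
rewrite -integral_itv_obnd_cbnd; last exact: measurableT_comp.
by rewrite -integral_itv_bndo_bndc//; exact: measurableT_comp.
Qed.

Lemma ge0_rintegrableP (E : set R) f : measurable E -> (forall x, 0 <= f x) ->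
  rintegrable E f <->
  measurable_fun E f /\ (\int[mu]_(x in E) (f x)%:E < +oo)%E.
Proof.
move=> mE f0.
have e : (\int[mu]_(x in E) `|(f x)%:E| = \int[mu]_(x in E) (f x)%:E)%E.
  by apply: eq_integral => x _; rewrite gee0_abs// lee_fin.
split=> [fi|[mf fi]].
  split; first exact: rintegrable_measurable.
  by rewrite -e; have /integrableP[] := fi.
apply/integrableP; split; first exact/measurable_EFinP.
by rewrite e.
Qed.

Lemma le_rintegrable (E : set R) f g : measurable E -> measurable_fun E f ->
  (forall x, E x -> `|f x| <= g x) -> rintegrable E g -> rintegrable E f.
Proof.
move=> mE mf fg gi; apply: (le_integrable (mu := mu) mE _ _ gi).
  exact/measurable_EFinP.
by move=> x Ex; rewrite /= lee_fin (le_trans (fg x Ex))// ler_norm.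
Qed.

(** Real square-integrability, to which that of complex functions and vectors is
    reduced by parts and components. *)
Definition L2fun tau f :=
  measurable_fun `]0, tau[ f /\ rintegrable `]0, tau[ (fun x => f x ^+ 2).

Lemma rintegrable_cc_oo tau f : rintegrable `[0, tau] f -> rintegrable `]0, tau[ f.
Proof. by apply: integrableS => //; exact: subset_itv_oo_cc. Qed.

Lemma continuous_L2fun tau f : {within `[0, tau], continuous f} -> L2fun tau f.
Proof.
move=> cf; split.
  exact: rintegrable_measurable (rintegrable_cc_oo (continuous_rintegrable cf)).
apply/rintegrable_cc_oo/continuous_rintegrable => x.
by apply: cvgM; exact: cf.
Qed.

Lemma L2fun_rintegrable tau f : L2fun tau f -> rintegrable `]0, tau[ f.
Proof.
move=> [mf f2].
apply: (@le_rintegrable _ _ (fun x => 1 + f x ^+ 2)) => //.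
  move=> x _; rewrite -[f x ^+ 2]real_normK ?num_real//.
  by have := sqr_ge0 (`|f x| - 1); nra.
apply: rintegrableD => //; apply/rintegrable_cc_oo/continuous_rintegrable.
by apply: continuous_subspaceT; exact: cst_continuous.
Qed.

Lemma L2funD tau f g : L2fun tau f -> L2fun tau g -> L2fun tau (fun x => f x + g x).
Proof.
move=> [mf f2] [mg g2].
have mfg : measurable_fun `]0, tau[ (fun x => f x + g x) by exact: measurable_funD.
split => //.
apply: (@le_rintegrable _ _ (fun x => 2 * f x ^+ 2 + 2 * g x ^+ 2)) => //.
- exact: measurable_funX.
- move=> x _; rewrite ger0_norm ?sqr_ge0//.
  by have := sqr_ge0 (f x - g x); nra.
- by apply: rintegrableD => //; exact: rintegrableZ.
Qed.

Lemma L2funZ tau f (c : R) : L2fun tau f -> L2fun tau (fun x => c * f x).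
Proof.
move=> [mf f2]; split; first exact: measurable_funM.
by under [X in rintegrable _ X]eq_fun do rewrite exprMn; exact: rintegrableZ.
Qed.

Lemma eq_L2fun tau f g : (forall x, 0 < x < tau -> f x = g x) -> L2fun tau f -> L2fun tau g.
Proof.
move=> fg; have {}fg : {in `]0, tau[%classic, f =1 g}.
  by move=> x; rewrite inE/= in_itv/= => /fg.
move=> [mf f2]; split; first exact: eq_measurable_fun fg mf.
by apply: eq_rintegrable f2 => // x xI; rewrite fg.
Qed.

End square_integrability.

Section complex_square_integrability.
Context {R : realType}.
Local Notation mu := (@lebesgue_measure R).
Implicit Types (tau : R) (f g : R -> R[i]).

Lemma square_integrableP tau f : square_integrable tau f <->
  L2fun tau (fun x => Re (f x)) /\ L2fun tau (fun x => Im (f x)).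
Proof.
have sq x : normc (f x) ^+ 2 = Re (f x) ^+ 2 + Im (f x) ^+ 2 by exact: sqr_normc.
have eI : (\int[mu]_(x in `]0%R, tau[) (normc (f x) ^+ 2)%:E =
    \int[mu]_(x in `]0%R, tau[) (Re (f x) ^+ 2 + Im (f x) ^+ 2)%:E)%E.
  by apply: eq_integral => x _; rewrite sq.
have ge0P := @ge0_rintegrableP R `]0, tau[ (fun x => Re (f x) ^+ 2 + Im (f x) ^+ 2).
split=> [[[mr mi]]|[[mr ir] [mi ii]]].
  rewrite eI => fi.
  have {}fi : rintegrable `]0, tau[ (fun x => Re (f x) ^+ 2 + Im (f x) ^+ 2).
    apply/ge0P => //; first by move=> x; rewrite addr_ge0 ?sqr_ge0.
    by split => //; apply: measurable_funD; exact: measurable_funX.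
  split; split => //.
  - apply: le_rintegrable fi => //; first exact: measurable_funX.
    by move=> x _; rewrite ger0_norm ?sqr_ge0// lerDl sqr_ge0.
  - apply: le_rintegrable fi => //; first exact: measurable_funX.
    by move=> x _; rewrite ger0_norm ?sqr_ge0// lerDr sqr_ge0.
split => //; rewrite eI.
have /ge0P[] // : rintegrable `]0, tau[ (fun x => Re (f x) ^+ 2 + Im (f x) ^+ 2).
  exact: rintegrableD.
by move=> x; rewrite addr_ge0 ?sqr_ge0.
Qed.

Lemma square_integrable_cintegrable tau f :
  square_integrable tau f -> cintegrable `[0, tau] f.
Proof.
by move=> /square_integrableP[fr fi]; split; exact/rintegrable_oo_cc/L2fun_rintegrable.
Qed.

Lemma continuous_square_integrable tau f :
  {within `[0, tau], continuous f} -> square_integrable tau f.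
Proof.
move=> /within_continuous_complexP[fr fi]; apply/square_integrableP.
by split; exact: continuous_L2fun.
Qed.

Lemma eq_square_integrable tau f g : (forall x, 0 < x < tau -> f x = g x) ->
  square_integrable tau f -> square_integrable tau g.
Proof.
move=> fg /square_integrableP[fr fi]; apply/square_integrableP.
by split; [move: fr|move: fi]; apply: eq_L2fun => x /fg ->.
Qed.

Lemma square_integrableD tau f g : square_integrable tau f -> square_integrable tau g ->
  square_integrable tau (fun x => f x + g x).
Proof.
move=> /square_integrableP[fr fi] /square_integrableP[gr gi]; apply/square_integrableP.
split.
- by under [X in L2fun _ X]eq_fun do rewrite ReD; exact: L2funD.
- by under [X in L2fun _ X]eq_fun do rewrite ImD; exact: L2funD.
Qed.

Lemma square_integrableZ tau f (c : R[i]) : square_integrable tau f ->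
  square_integrable tau (fun x => c * f x).
Proof.
move=> /square_integrableP[fr fi]; apply/square_integrableP; split.
- under [X in L2fun _ X]eq_fun do rewrite ReM -mulNr.
  by apply: L2funD; exact: L2funZ.
- under [X in L2fun _ X]eq_fun do rewrite ImM.
  by apply: L2funD; exact: L2funZ.
Qed.

Lemma square_integrable0 tau : square_integrable tau (fun=> 0).
Proof. by apply: continuous_square_integrable; apply: continuous_subspaceT; exact: cst_continuous. Qed.

Lemma square_integrable_sum tau (I : Type) (r : seq I) (f : I -> R -> R[i]) :
  (forall i, square_integrable tau (f i)) ->
  square_integrable tau (fun x => \sum_(i <- r) f i x).
Proof.
move=> fi; elim: r => [|i r ih].
  by under eq_fun do rewrite big_nil; exact: square_integrable0.
by under eq_fun do rewrite big_cons; exact: square_integrableD.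
Qed.

Lemma vsquare_integrableP tau p (u : R -> 'cV[R[i]]_p) : vsquare_integrable tau u <->
  forall i, square_integrable tau (fun x => u x i ord0).
Proof.
have rI (h : R -> R) : measurable_fun `]0, tau[ h -> (forall x, 0 <= h x) ->
    (\int[mu]_(x in `]0%R, tau[) (h x)%:E < +oo)%E <-> rintegrable `]0, tau[ h.
  move=> mh h0; split=> hi; first by apply/ge0_rintegrableP.
  by have [] := (@ge0_rintegrableP R `]0, tau[ h (measurable_itv _) h0).1 hi.
have mN i : cmeasurable_fun `]0, tau[ (fun x => u x i ord0) ->
    measurable_fun `]0, tau[ (fun x => normc (u x i ord0) ^+ 2).
  move=> [mr mi]; under [X in measurable_fun _ X]eq_fun do rewrite sqr_normc.
  by apply: measurable_funD; exact: measurable_funX.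
have mS : (forall i : 'I_p, cmeasurable_fun `]0, tau[ (fun x => u x i ord0)) ->
    measurable_fun `]0, tau[ (fun x => \sum_(i < p) normc (u x i ord0) ^+ 2).
  by move=> mu_; apply: measurable_sum => i; exact: mN.
split=> [[mu_ ui] i|ui].
  split; first exact: mu_.
  apply/rI; [exact: mN|by move=> x; rewrite sqr_ge0|].
  move/rI : ui => /(_ (mS mu_)) ui.
  apply: le_rintegrable (ui _) => //; first exact: mN.
    move=> x _; rewrite ger0_norm ?sqr_ge0// (bigD1 i)//= lerDl sumr_ge0// => *.
    exact: sqr_ge0.
  by move=> x; apply: sumr_ge0 => *; exact: sqr_ge0.
have mu_ i : cmeasurable_fun `]0, tau[ (fun x => u x i ord0) by case: (ui i).
split => //; apply/rI; [exact: mS|by move=> x; apply: sumr_ge0 => *; exact: sqr_ge0|].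
rewrite /rintegrable.
have -> : EFin \o (fun x => \sum_(i < p) normc (u x i ord0) ^+ 2) =
    (fun x => \sum_(i < p) (normc (u x i ord0) ^+ 2)%:E)%E.
  by apply/funext => x; rewrite /= sumEFin.
apply: integrable_sum => // i _.
by have [_] := ui i; rewrite rI//; [exact: mN|move=> x; exact: sqr_ge0].
Qed.

End complex_square_integrability.

(** * The range of the input-output map *)

Section input_output.
Context {R : realType} (d p : nat).
Variables (A : 'M[R[i]]_d) (B : 'M[R[i]]_(d, p)) (tau : R) (htau : 0 < tau).
Implicit Types (C : 'M[R[i]]_(1, d)) (D : 'M[R[i]]_(1, p)) (u : R -> 'cV[R[i]]_p).

Definition state u : R -> 'cV[R[i]]_d := duhamel A (fun s => B *m u s).

Let tau0 : 0 <= tau := ltW htau.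

Lemma vsquare_integrable_mxintegrable u : vsquare_integrable tau u -> mxintegrable tau u.
Proof.
move=> /vsquare_integrableP ui i j; rewrite (ord1 j).
exact: square_integrable_cintegrable.
Qed.

Lemma mxintegrable_input u : mxintegrable tau u -> mxintegrable tau (fun s => B *m u s).
Proof. by apply: mxintegrableM; exact: mxcontinuous_cst. Qed.

Lemma state_solution u : mxintegrable tau u ->
  solution A (fun s => B *m u s) tau (state u).
Proof. by move=> iu; exact: duhamel_solution tau0 (mxintegrable_input iu). Qed.

Lemma io_mapE C D u t : 0 <= t <= tau -> mxintegrable tau u ->
  io_map A B C D u t = (C *m state u t + D *m u t) ord0 ord0.
Proof.
move=> /andP[t0 tt] iu.
have iBu : mxintegrable t (fun s => B *m u s).
  exact: mxintegrableW tt (mxintegrable_input iu).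
have iE := mxintegrableM (mxderive_continuous (t := t) (mxderive_expmx_rev A t)) iBu.
have e : mxprimitive (fun s => C *m (expmx ((t - s)%:C *: A) *m (B *m u s))) t =
    C *m state u t := mxprimitive_mulmxl C iE.
rewrite mxE -e mxE; congr (_ + _); apply: eq_cintegral => s _.
by rewrite !mulmxA.
Qed.

Lemma io_map_square_integrable C D u : vsquare_integrable tau u ->
  square_integrable tau (io_map A B C D u).
Proof.
move=> u2; have iu := vsquare_integrable_mxintegrable u2.
have [xc _] := state_solution iu.
apply: (@eq_square_integrable _ _ (fun t => (C *m state u t) ord0 ord0 +
    \sum_j D ord0 j * u t j ord0)).
  move=> t /andP[t0 tt]; rewrite io_mapE//; last by rewrite !ltW.
  by rewrite [RHS]mxE; congr (_ + _); rewrite mxE.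
apply: square_integrableD.
  apply: continuous_square_integrable.
  exact: mxcontinuousM (@mxcontinuous_cst _ _ _ tau C) xc ord0 ord0.
apply: square_integrable_sum => j; apply: square_integrableZ.
exact: (vsquare_integrableP tau u).1.
Qed.

(** The output y = Cx of a strictly proper system is the primitive of
    y' = CAx + CBu, which is itself an output. *)
Lemma io_map_primitive C u t : 0 <= t <= tau -> vsquare_integrable tau u ->
  io_map A B C 0 u t = cprimitive (io_map A B (C *m A) (C *m B) u) t.
Proof.
move=> tT u2; have iu := vsquare_integrable_mxintegrable u2.
have [xc xE] := state_solution iu.
have /andP[t0 tt] := tT.
have iAx : mxintegrable t (fun s => A *m state u s + B *m u s).
  apply: mxintegrableD; last exact: mxintegrableW tt (mxintegrable_input iu).
  apply: mxintegrableM; first exact: mxcontinuous_cst.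
  exact: mxcontinuous_integrable (mxcontinuousW tt xc).
rewrite io_mapE// mul0mx addr0 (xE t tT) -mxprimitive_mulmxl// mxE.
apply: eq_cintegral => s; rewrite inE/= in_itv/= => /andP[s0 st].
by rewrite io_mapE ?s0 ?(le_trans st)// mulmxDr !mulmxA.
Qed.

End input_output.

(** Cayley-Hamilton: A^k with k >= d is a combination of the d preceding powers. *)
Lemma Cayley_Hamilton_sandwich (F : fieldType) (d m n : nat) (A : 'M[F]_d)
    (C : 'M[F]_(m, d)) (B : 'M[F]_(d, n)) :
  (forall k, (k <= d.-1)%N -> C *m A ^+ k *m B = 0) ->
  forall k, C *m A ^+ k *m B = 0.
Proof.
case: d => [|d'] in A C B *; first by move=> _ k; rewrite [B]flatmx0 mulmx0.
move=> CAB; elim/ltn_ind => k ih.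
have [kd|dk] := leqP k d'; first exact: CAB.
pose c := char_poly A.
have cE : \sum_(i < d'.+2) c`_i *: A ^+ i = 0.
  rewrite -[RHS](Cayley_Hamilton A) -/c -[in RHS](coefK c) poly_def size_char_poly.
  rewrite rmorph_sum; apply: eq_bigr => i _.
  by rewrite /= horner_mxZ rmorphXn /= horner_mx_X.
have cd : c`_d'.+1 = 1.
  by have := char_poly_monic A; rewrite monicE lead_coefE size_char_poly => /eqP.
move: cE; rewrite big_ord_recr/= cd scale1r => /eqP; rewrite addrC addr_eq0 => /eqP Ad.
rewrite -(subnK dk) exprD -[_ * _]/(_ *m _) Ad mulmxN mulmx_sumr mulmxN mulNmx.
rewrite mulmx_sumr mulmx_suml big1 ?oppr0// => i _.
rewrite -scalemxAr -scalemxAr -scalemxAl.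
rewrite -[A ^+ _ *m A ^+ _]/(A ^+ _ * A ^+ _) -exprD ih ?scaler0//.
by rewrite -[X in (_ < X)%N](subnK dk) ltn_add2l.
Qed.

Section range.
Context {R : realType} (d p : nat).
Variables (A : 'M[R[i]]_d) (B : 'M[R[i]]_(d, p)) (tau : R) (htau : 0 < tau).
Implicit Types (C : 'M[R[i]]_(1, d)) (D : 'M[R[i]]_(1, p)) (u : R -> 'cV[R[i]]_p).

Let tau0 : 0 <= tau := ltW htau.

(** Inversion by feedback, using the input component j with D_j <> 0 alone:
    solving y = Cx + D_j v for v turns x' = Ax + bv, where b is the j-th column of
    B, into x' = (A - b C / D_j) x + b y / D_j, a system driven by y. *)
Lemma io_map_onto C D (y : R -> R[i]) : D <> 0 -> square_integrable tau y ->
  exists2 u, vsquare_integrable tau u &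
    forall t, 0 <= t <= tau -> io_map A B C D u t = y t.
Proof.
move=> D0 y2.
have [j Dj] : exists j, D ord0 j != 0.
  apply/not_existsP => Dn; apply: D0; apply/rowP => j; rewrite mxE.
  by apply/eqP; apply: contra_notT (Dn j).
pose e : 'cV[R[i]]_p := delta_mx j ord0.
pose b := B *m e; pose dl := D ord0 j.
have De : D *m e = dl%:M.
  apply/matrixP => i k; rewrite !ord1 !mxE eqxx mulr1n.
  rewrite (bigD1 j)//= !mxE !eqxx mulr1 big1 ?addr0// => l lj.
  by rewrite !mxE (negbTE lj) mulr0.
(* The feedback system: its matrix and the forcing term b y / D_j. *)
pose A' := A - dl^-1 *: (b *m C).
pose f s : 'cV[R[i]]_d := (dl^-1 * y s) *: b.
have fi : mxintegrable tau f.
  move=> i k; have -> : (fun s => f s i k) = (fun s => (dl^-1 * b i k) * y s).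
    by apply/funext => s; rewrite mxE; ring.
  by apply: cintegrableZ => //; exact: square_integrable_cintegrable.
have [xc xE] := duhamel_solution A' tau0 fi.
set x := duhamel A' f in xc xE.
pose v s := dl^-1 * (y s + (-1) * (C *m x s) ord0 ord0).
pose u s := v s *: e.
have u2 : vsquare_integrable tau u.
  apply/vsquare_integrableP => i.
  have -> : (fun s => u s i ord0) = (fun s => (e i ord0 * dl^-1) *
      (y s + (-1) * (C *m x s) ord0 ord0)).
    by apply/funext => s; rewrite mxE /v; ring.
  apply/square_integrableZ/square_integrableD => //; apply: square_integrableZ.
  apply: continuous_square_integrable.
  exact: mxcontinuousM (@mxcontinuous_cst _ _ _ tau C) xc ord0 ord0.
have iu := vsquare_integrable_mxintegrable u2.
have xs : solution A (fun s => B *m u s) tau x.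
  split => // t tT; rewrite (xE t tT); apply: eq_mxprimitive => s _.
  have bC : b *m C *m x s = (C *m x s) ord0 ord0 *: b.
    by rewrite -mulmxA {1}[C *m x s]mx11_scalar mul_mx_scalar.
  rewrite /A' mulmxBl -scalemxAl bC /f /u -scalemxAr -/b /v.
  rewrite mulN1r mulrDr scalerDl mulrN scaleNr scalerA.
  by rewrite -addrA [- _ + _]addrC.
have xst t : 0 <= t <= tau -> x t = state A B u t.
  exact: solution_duhamel (mxintegrable_input B iu) xs.
exists u => // t tT; rewrite (io_mapE A B C D tT iu) -(xst t tT) /u -scalemxAr De.
rewrite mxE (_ : (v t *: dl%:M) ord0 ord0 = dl * v t); last first.
  by rewrite !mxE eqxx mulr1n mulrC.
by rewrite /v mulVKf// mulN1r addrC subrK.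
Qed.

(** As long as the feedthrough C A^k B of the differentiated output vanishes, the
    output can be differentiated once more. *)
Lemma io_map_iter_primitive nu C u t : 0 <= t <= tau -> vsquare_integrable tau u ->
  (forall k, (k < nu)%N -> C *m A ^+ k *m B = 0) ->
  io_map A B C 0 u t =
  iter nu.+1 cprimitive (io_map A B (C *m A ^+ nu.+1) (C *m A ^+ nu *m B) u) t.
Proof.
move=> tT u2; elim: nu C t tT => [|nu ih] C t tT CAB.
  by rewrite iterS expr1 expr0 mulmx1; exact: (io_map_primitive A B htau C tT u2).
rewrite (io_map_primitive A B htau C tT u2) iterS; apply: eq_cintegral => s.
rewrite inE/= in_itv/= => /andP[s0 st].
have := CAB 0%N isT; rewrite expr0 mulmx1 => ->.
have AS k : C *m A *m A ^+ k = C *m A ^+ k.+1 by rewrite exprS mulmxA.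
rewrite ih; first by rewrite !AS.
- by rewrite s0 (le_trans st)//; case/andP: tT.
- by move=> k knu; rewrite AS; exact: CAB.
Qed.

Lemma ae_class_eq_ae (f g : R -> R[i]) :
  f = g %[ae (@lebesgue_measure R) in `]0, tau[%classic] ->
  ae_class tau f = ae_class tau g.
Proof.
move=> fg; apply/seteqP; split=> h /= fh.
- exact: ae_eq_trans (ae_eq_sym fg) fh.
- exact: ae_eq_trans fg fh.
Qed.

Lemma ae_class_eq (f g : R -> R[i]) : (forall t, 0 < t < tau -> f t = g t) ->
  ae_class tau f = ae_class tau g.
Proof.
by move=> fg; apply: ae_class_eq_ae; apply: aeW => t; rewrite /= in_itv/= => /fg.
Qed.

Lemma io_range_feedthrough C D : D <> 0 -> io_range A B C D tau = L2 tau.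
Proof.
move=> D0; apply/seteqP; split=> _ [f f2 <-].
  by exists (io_map A B C D f) => //; exact: io_map_square_integrable.
have [u u2 uE] := io_map_onto C D0 f2.
exists u => //; apply: ae_class_eq => t /andP[t0 tt].
by rewrite uE// !ltW.
Qed.

Lemma eq_iter_cprimitive n (f g : R -> R[i]) :
  (forall t, 0 <= t <= tau -> f t = g t) ->
  forall t, 0 <= t <= tau -> iter n cprimitive f t = iter n cprimitive g t.
Proof.
move=> fg; elim: n => [|n ih] t tT; first exact: fg.
rewrite !iterS; apply: eq_cintegral => s; rewrite inE/= in_itv/= => /andP[s0 st].
by apply: ih; rewrite s0 (le_trans st)//; case/andP: tT.
Qed.

(** The system (A, B, C A^(nu+1), C A^nu B) has nonzero feedthrough, so its outputs
    are all of L^2. *)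
Lemma io_range_integrated nu C :
  (forall k, (k < nu)%N -> C *m A ^+ k *m B = 0) -> C *m A ^+ nu *m B <> 0 ->
  io_range A B C 0 tau =
  [set ae_class tau (iter nu.+1 cprimitive g) | g in square_integrable tau].
Proof.
move=> CAB CAB0.
have pE u t : vsquare_integrable tau u -> 0 < t < tau -> io_map A B C 0 u t =
    iter nu.+1 cprimitive (io_map A B (C *m A ^+ nu.+1) (C *m A ^+ nu *m B) u) t.
  by move=> u2 /andP[t0 tt]; apply: io_map_iter_primitive => //; rewrite !ltW.
apply/seteqP; split=> _ [f f2 <-].
  exists (io_map A B (C *m A ^+ nu.+1) (C *m A ^+ nu *m B) f).
    exact: io_map_square_integrable.
  by apply: ae_class_eq => t tT; rewrite -pE.
have [u u2 uE] := io_map_onto (C *m A ^+ nu.+1) CAB0 f2.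
exists u => //; apply: ae_class_eq => t tT; rewrite (pE u t u2 tT).
by apply: (eq_iter_cprimitive nu.+1 uE); case/andP: tT => /ltW -> /ltW ->.
Qed.


Lemma io_range_zero C : (forall k, (k <= d.-1)%N -> C *m A ^+ k *m B = 0) ->
  io_range A B C 0 tau = [set ae_class tau (fun=> 0)].
Proof.
move=> /Cayley_Hamilton_sandwich CAB.
have E0 t : C *m expmx (t%:C *: A) *m B = 0.
  rewrite (@eq_expmx_sandwich _ _ _ _ _ _ 0 _ B); first by rewrite !mul0mx.
  by move=> k; rewrite CAB !mul0mx.
have io0 u t : io_map A B C 0 u t = 0.
  rewrite /io_map mul0mx !mxE addr0 -(cintegral0 `[0, t]); apply: eq_cintegral => s _.
  by rewrite E0 mul0mx mxE.
apply/seteqP; split=> [_ [u _ <-]|_ ->]; first exact: ae_class_eq.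
exists (fun=> 0); last exact: ae_class_eq.
apply/vsquare_integrableP => i; under eq_fun do rewrite mxE.
exact: square_integrable0.
Qed.

End range.

(** * Smoothness and flat exponentials *)

Section differentiability_class.
Context {R : realType}.
Implicit Types f g : R -> R.

(** Everywhere [n] times differentiable. Unlike the iterated [derive1], the
    existence of derivatives lends itself to induction on sums and products. *)
Fixpoint Ck (n : nat) f : Prop :=
  if n is m.+1 then
    exists2 f', (forall x : R, is_derive x (1 : R) f (f' x)) & Ck m f'
  else True.

Lemma CkW n f : Ck n.+1 f -> Ck n f.
Proof.
elim: n f => //= n ih f [f' df [f'' df' cf]].
by exists f' => //; apply: ih; exists f''.
Qed.

Lemma Ck_cst n (c : R) : Ck n (fun=> c).
Proof.
elim: n c => //= n ih c; exists (fun=> 0) => //.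
by move=> x; exact: is_derive_cst.
Qed.

Lemma CkD n f g : Ck n f -> Ck n g -> Ck n (fun x => f x + g x).
Proof.
elim: n f g => //= n ih f g [f' df cf] [g' dg cg].
by exists (fun x => f' x + g' x); [move=> x; exact: is_deriveD|exact: ih].
Qed.

Lemma CkM n f g : Ck n f -> Ck n g -> Ck n (fun x => f x * g x).
Proof.
elim: n f g => // n ih f g cf cg; have cf1 := CkW cf; have cg1 := CkW cg.
case: cf cg => [f' df cf] [g' dg cg].
exists (fun x => f x * g' x + g x * f' x).
  by move=> x; exact: is_deriveM.
by apply: CkD; apply: ih.
Qed.

Lemma Ck_affine n f (a b : R) : Ck n f -> Ck n (fun x => f (a * x + b)).
Proof.
elim: n f => //= n ih f [f' df cf].
exists (fun x => a * f' (a * x + b)); last by apply: CkM; [exact: Ck_cst|exact: ih].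
move=> x; have ab : is_derive x (1:R) (fun s : R => a * s + b) a.
  by apply: is_derive_eq; rewrite /GRing.scale /= mulr1 addr0.
have := @is_derive1_comp R f (fun s => a * s + b) x _ _ (df _) ab.
by rewrite mulrC.
Qed.

Lemma Ck_derivable f : (forall n, Ck n f) ->
  forall n x, derivable (derive1n n f) x (1 : R).
Proof.
move=> cf n; have {cf} : Ck n.+1 f by exact: cf.
elim: n f => [|n ih] f [f' df cf] x.
  exact: (@ex_derive _ _ _ _ _ _ _ (df x)).
have f'E : derive1 f = f'.
  by apply/funext => y; rewrite derive1E; exact: (@derive_val _ _ _ _ _ _ _ (df y)).
by rewrite /derive1n iterSr f'E; exact: ih.
Qed.

(** The functions x^-n e^(-c/x) on x > 0, extended by 0: a family of which the
    linear span is closed under derivation, whence smoothness. *)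
Definition flat_exp (n : nat) (c x : R) : R :=
  if 0 < x then x^-1 ^+ n * expR (- c * x^-1) else 0.

(** From e^y >= y^(n+2) / (n+2)! at y = c / x; the factor x^2 makes the derivative
    at 0 vanish. *)
Lemma flat_exp_le n (c x : R) : 0 < c -> 0 <= x ->
  0 <= flat_exp n c x <= (n.+2)`!%:R / c ^+ n.+2 * x ^+ 2.
Proof.
move=> c0; rewrite /flat_exp le_eqVlt => /predU1P[<-|x0].
  by rewrite ltxx lexx expr0n/= mulr0.
have y0 : 0 < x^-1 by rewrite invr_gt0.
rewrite x0; apply/andP; split.
  by rewrite mulr_ge0 ?expR_ge0 ?exprn_ge0 ?invr_ge0 ?ltW.
have h : (c * x^-1) ^+ n.+2 <= (n.+2)`!%:R * expR (c * x^-1).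
  rewrite [leRHS]mulrC -ler_pdivrMr ?ltr0n ?fact_gt0//.
  by rewrite (le_trans _ (expR_ge1Dxn n.+1 (ltW (mulr_gt0 c0 y0))))// lerDr.
rewrite mulNr expRN ler_pdivrMr ?expR_gt0//.
have -> : x^-1 ^+ n = (c * x^-1) ^+ n.+2 / c ^+ n.+2 * x ^+ 2.
  rewrite exprMn [X in X * _]mulrAC divff ?expf_neq0 ?gt_eqF// mul1r -addn2 exprD -mulrA -exprMn.
  by rewrite mulVf ?gt_eqF// expr1n mulr1.
rewrite [leRHS]mulrAC; apply: ler_wpM2r; first by rewrite exprn_ge0// ltW.
rewrite [leRHS]mulrAC; apply: ler_wpM2r => //.
by rewrite invr_ge0 exprn_ge0// ltW.
Qed.

Lemma is_derive_flat_exp n (c x : R) : 0 < c ->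
  is_derive x (1 : R) (flat_exp n c)
    (c * flat_exp n.+2 c x + - n%:R * flat_exp n.+1 c x).
Proof.
move=> c0; have [x0|x0|x0] := ltgtP 0 x.
- apply: (@near_eq_is_derive R R R (fun y => y^-1 ^+ n * expR (- c * y^-1))).
    near=> y; rewrite /flat_exp ifT//; near: y.
    exact: lt_nbhsr.
  rewrite /flat_exp x0.
  have xn0 : x != 0 by rewrite gt_eqF.
  have dV : is_derive x (1 : R) (fun y : R => y^-1) (- x ^- 2).
    have := @is_deriveV R id x 1 1 xn0 (is_derive_id x 1).
    by rewrite /GRing.scale/= mulr1.
  have dE : is_derive x (1 : R) (fun y : R => expR (- c * y^-1))
      (expR (- c * x^-1) * (- c * (- x ^- 2))).
    have d1 : is_derive x (1 : R) (fun y : R => - c * y^-1) (- c * (- x ^- 2)).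
      by apply: is_derive_eq; rewrite /GRing.scale /= ?mulr0 ?addr0.
    exact: (@is_derive1_comp R expR _ x _ _ (is_derive_expR _) d1).
  have dX : is_derive x (1 : R) (fun y : R => y^-1 ^+ n) (- n%:R * x^-1 ^+ n.+1).
    have := @is_deriveX R R (fun y => y^-1) n x 1 _ dV.
    rewrite (_ : (fun y : R => y^-1) ^+ n = (fun y : R => y^-1 ^+ n)); last first.
      by apply/funext => y; elim: (n) => [|m ih]; rewrite ?expr0// !exprS -ih.
    rewrite /GRing.scale/= mulrN -exprVn -mulrA -exprD mulNr.
    by case: (n) => [|m]; rewrite ?mul0r// addn2.
  have := is_deriveM dX dE; rewrite /GRing.scale/=.
  rewrite -exprVn; set e := expR _; set y := x^-1 => h.
  apply: is_derive_eq h _; rewrite !exprS; ring.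
- apply: (@near_eq_is_derive R R R (fun=> 0)).
    near=> y; rewrite /flat_exp ifF//; apply/negbTE; rewrite -leNgt ltW//.
    by near: y; exact: lt_nbhsl.
  rewrite /flat_exp [0 < x]ltNge ltW//= !mulr0 addr0; exact: is_derive_cst.
- rewrite -x0 /flat_exp ltxx !mulr0 addr0.
  (* The difference quotient at 0 is at most K |h|. *)
  set K : R := (n.+2)`!%:R / c ^+ n.+2.
  have K0 : 0 < K by rewrite divr_gt0 ?ltr0n ?fact_gt0 ?exprn_gt0.
  have cv : h^-1 *: (flat_exp n c (h *: 1 + 0) - flat_exp n c 0) @[h --> (0:R)^'] --> (0 : R).
    apply/cvgrPdist_le => e e0; near=> h.
    rewrite sub0r normrN addr0 /GRing.scale/= mulr1 {2}/flat_exp ltxx subr0 normrM.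
    have h0 : h != 0 by near: h; exact: nbhs_dnbhs_neq.
    have he : `|h| <= e / K.
      near: h; apply: nbhs_dnbhs; near=> h; rewrite -[h]subr0 -normrN opprB.
      by apply/ltW; near: h; apply: nbhsx_ballx; rewrite divr_gt0.
    rewrite normfV ler_pdivrMl ?normr_gt0//.
    have [hp|hn] := ltP 0 h; last by rewrite /flat_exp ltNge hn/= normr0 mulr_ge0// ltW.
    have /andP[f0 fK] := flat_exp_le n c0 (ltW hp).
    rewrite (gtr0_norm hp) in he *; rewrite ger0_norm// (le_trans fK)// -/K.
    by rewrite expr2 mulrCA ler_pM2l// mulrC -ler_pdivlMr.
  split; last exact: cvg_lim.
  by apply: cvgP cv.
Unshelve. all: by end_near. Qed.

Lemma Ck_flat_exp k n (c : R) : 0 < c -> Ck k (flat_exp n c).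
Proof.
move=> c0; elim: k n => // k ih n.
exists (fun x => c * flat_exp n.+2 c x + - n%:R * flat_exp n.+1 c x).
  by move=> x; exact: is_derive_flat_exp.
by apply: CkD; apply: CkM; (exact: Ck_cst || exact: ih).
Qed.

End differentiability_class.

(** * Bump functions and the fundamental lemma *)

Section bump_functions.
Context {R : realType}.
Local Notation mu := (@lebesgue_measure R).
Implicit Types (a b c tau : R) (h : R -> R).

(** A smooth function, positive on ]a, b[ and zero outside; as c tends to 0 it
    increases to the indicator of ]a, b[. *)
Definition bump a b c (x : R) : R := flat_exp 0 c (x - a) * flat_exp 0 c (b - x).

Lemma flat_exp0_itv c (x : R) : 0 < c -> 0 <= flat_exp 0 c x <= 1.
Proof.
move=> c0; rewrite /flat_exp; case: ltP => x0; last by rewrite lexx ler01.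
rewrite expr0 mul1r expR_ge0/= mulNr expRN invf_le1 ?expR_gt0//.
by rewrite -expR0 ler_expR divr_ge0 ?ltW.
Qed.

Lemma bump_itv a b c x : 0 < c -> 0 <= bump a b c x <= 1.
Proof.
move=> c0; have /andP[u0 u1] := flat_exp0_itv (x - a) c0.
have /andP[v0 v1] := flat_exp0_itv (b - x) c0.
by rewrite /bump mulr_ge0//= mulr_ile1.
Qed.

Lemma bump_out a b c x : x \notin `]a, b[ -> bump a b c x = 0.
Proof.
rewrite in_itv/= negb_and -!leNgt /bump /flat_exp => /orP[xa|bx].
  by rewrite subr_gt0 ltNge xa/= mul0r.
by rewrite [0 < b - x]ltNge subr_le0 bx/= mulr0.
Qed.

Lemma bump_gt0 a b c x : x \in `]a, b[ -> 0 < bump a b c x.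
Proof.
rewrite in_itv/= /bump /flat_exp => /andP[ax xb].
by rewrite !subr_gt0 ax xb !expr0 !mul1r mulr_gt0// expR_gt0.
Qed.

Lemma Ck_bump k a b c : 0 < c -> Ck k (bump a b c).
Proof.
move=> c0; apply: CkM.
  have -> : (fun x => flat_exp 0 c (x - a)) = (fun x => flat_exp 0 c (1 * x + - a)).
    by apply/funext => x; rewrite mul1r.
  exact: Ck_affine (Ck_flat_exp _ _ c0).
have -> : (fun x => flat_exp 0 c (b - x)) = (fun x => flat_exp 0 c (-1 * x + b)).
  by apply/funext => x; rewrite mulN1r addrC.
exact: Ck_affine (Ck_flat_exp _ _ c0).
Qed.

Lemma Ck1_continuous (f : R -> R) : Ck 1 f -> continuous f.
Proof.
move=> [f' df _] x; apply/differentiable_continuous/derivable1_diffP.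
exact: (@ex_derive _ _ _ _ _ _ _ (df x)).
Qed.

Lemma bump_continuous a b c : 0 < c -> continuous (bump a b c).
Proof. by move=> c0; exact: Ck1_continuous (Ck_bump 1 a b c0). Qed.

Lemma test_function_bump tau a b c : 0 < a -> b < tau -> 0 < c ->
  test_function tau (bump a b c).
Proof.
move=> a0 btau c0; split.
  by apply: Ck_derivable => n; exact: Ck_bump.
exists a, b; split => // x; move=> xab; apply: bump_out.
by apply: contra xab; exact: subset_itv_oo_cc.
Qed.

Lemma cvg_flat_exp0 (x : R) :
  flat_exp 0 n.+1%:R^-1 x @[n --> \oo] --> ((0 < x)%R%:R : R).
Proof.
rewrite /flat_exp; case: ltP => x0; last exact: cvg_cst.
rewrite (_ : true%:R = expR 0 :> R); last by rewrite expR0.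
under eq_fun do rewrite expr0 mul1r.
have h0 : - n.+1%:R^-1 * x^-1 @[n --> \oo] --> (0 : R).
  rewrite -(mul0r x^-1) -oppr0; apply: cvgM; last exact: cvg_cst.
  by apply: cvgN; exact: cvg_harmonic.
exact: (cvg_comp _ _ h0 (@continuous_expR R 0)).
Qed.

Lemma cvg_bump a b (x : R) :
  bump a b n.+1%:R^-1 x @[n --> \oo] --> (\1_`]a, b[ x : R).
Proof.
rewrite indicE mem_setE in_itv/= -(subr_gt0 a) -(subr_gt0 x) -mulnb natrM.
by apply: cvgM; exact: cvg_flat_exp0.
Qed.

Lemma rintegrable_bounded_mul (E : set R) h (f : R -> R) : measurable E ->
  rintegrable E h -> measurable_fun E f -> (forall x, `|f x| <= 1) ->
  rintegrable E (fun x => h x * f x).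
Proof.
move=> mE hE mf f1.
apply: (@le_rintegrable _ _ _ (fun x => `|h x|)) => //.
- by apply: measurable_funM => //; exact: rintegrable_measurable.
- by move=> x _; rewrite normrM ler_piMr.
- exact: integrable_norm hE.
Qed.

(** Dominated convergence along the bumps of parameter c = 1 / (n + 1). *)
Lemma Rintegral_bump_eq0 tau a b h : rintegrable `]0, tau[ h ->
  0 < a -> b < tau ->
  (forall c, 0 < c -> \int[mu]_(x in `]0, tau[) (h x * bump a b c x) = 0) ->
  \int[mu]_(x in `]a, b[) h x = 0.
Proof.
move=> hi a0 btau h0.
have mE : measurable (`]0, tau[ : set R) by [].
have mh := rintegrable_measurable hi.
have c0 n : (0:R) < n.+1%:R^-1 by rewrite invr_gt0.
have mb n : measurable_fun `]0, tau[ (bump a b n.+1%:R^-1).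
  by apply: measurable_funTS; apply: continuous_measurable_fun; exact: bump_continuous.
have bi n : rintegrable `]0, tau[ (fun x => h x * bump a b n.+1%:R^-1 x).
  apply: rintegrable_bounded_mul => // x.
  by have /andP[u0 u1] := bump_itv a b x (c0 n); rewrite ger0_norm.
have := @dominated_cvg _ _ R mu `]0, tau[ mE
  (fun n x => (h x * bump a b n.+1%:R^-1 x)%:E) (fun x => (h x * \1_`]a, b[ x)%:E)
  (fun x => `|h x|%:E).
have -> : (fun n => \int[mu]_(x in `]0%R, tau[) (h x * bump a b n.+1%:R^-1 x)%:E)%E =
    (fun=> 0%E).
  apply/funext => n; rewrite -[LHS]fineK; last exact: integrable_fin_num (bi n).
  by rewrite [fine _](h0 _ (c0 n)).
move=> dc.
have {dc} : (0%E : \bar R) @[n --> \oo] -->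
    (\int[mu]_(x in `]0%R, tau[) (h x * \1_`]a, b[ x)%:E)%E.
  apply: dc => //.
  - by move=> n; apply/measurable_EFinP; exact: rintegrable_measurable (bi n).
  - move=> x _; apply: cvg_EFin; first by near=> n.
    by apply: cvgM; [exact: cvg_cst|exact: cvg_bump].
  - exact: integrable_norm hi.
  - move=> n x _; rewrite lee_fin normrM ler_piMr//.
    by have /andP[u0 u1] := bump_itv a b x (c0 n); rewrite ger0_norm.
move=> cv.
have e0 : (\int[mu]_(x in `]0%R, tau[) (h x * \1_`]a, b[ x)%:E = 0)%E.
  exact: (cvg_unique (@ereal_hausdorff R) cv (cvg_cst _)).
rewrite -[RHS](congr1 fine e0) -/(Rintegral _ _ _) Rintegral_mkcond [RHS]Rintegral_mkcond.
apply: eq_Rintegral => x _; rewrite !patchE indicE !mem_setE.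
have [xab|] := boolP (x \in `]a, b[); last by rewrite mulr0 if_same.
rewrite mulr1 ifT//; apply: subset_itv xab; rewrite bnd_simp; exact: ltW.
Unshelve. all: by end_near. Qed.

(** Fundamental lemma of the calculus of variations, for bumps only: the integral
    of [h] over each subinterval vanishes, so a primitive of [h] is constant, and
    its derivative is [h] almost everywhere by Lebesgue differentiation. *)
Lemma bump_fundamental tau h : rintegrable `]0, tau[ h ->
  (forall a b c, 0 < a -> a < b -> b < tau -> 0 < c ->
     \int[mu]_(x in `]0, tau[) (h x * bump a b c x) = 0) ->
  \forall x \ae mu, x \in `]0, tau[ -> h x = 0.
Proof.
move=> hi h0; pose H := h \_ `]0, tau[.
have mE : measurable (`]0, tau[ : set R) by [].
have Hi : rintegrable setT H by exact: rintegrable_patch.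
have Hloc : locally_integrable setT H by exact: integrable_locally.
pose F (x : R) := \int[mu]_(t in `]-oo, x]) H t.
have iy z : rintegrable `]-oo, z] H by apply: integrableS Hi.
have Fcst x y : 0 < x -> x < y -> y < tau -> F x = F y.
  move=> x0 xy yt; apply/eqP; rewrite eq_sym -subr_eq0 /F.
  rewrite Rintegral_itvB//; [|exact: iy|exact: ltW].
  rewrite -Rintegral_itv_bndo_bndc; last by apply: integrableS Hi.
  rewrite -(Rintegral_bump_eq0 hi x0 yt); last by move=> c c0; exact: h0.
  apply/eqP/eq_Rintegral => z; rewrite inE/= => zxy; rewrite /H patchE mem_setE.
  by rewrite ifT//; apply: subset_itv zxy; rewrite bnd_simp ltW.
have Fae := @FTC1 R H -oo%O iy Hloc.
have ff : Filter (almost_everywhere mu) by exact: ae_filter_ringOfSetsType.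
move: Fae; apply: (@filterS _ _ ff) => x /(_ (ltNyr _))[_ Fx].
rewrite in_itv/= => /andP[x0 xt].
have : is_derive x (1 : R) F 0.
  apply: (@near_eq_is_derive R R R (fun=> F x)).
  near=> y.
  have y0 : 0 < y by near: y; exact: lt_nbhsr.
  have yt : y < tau by near: y; exact: lt_nbhsl.
  by have [xy|yx|->] := ltgtP x y => //; [exact: Fcst|rewrite (Fcst y x)].
move=> /(@derive_val _ _ _ _ _ _ _); rewrite -derive1E Fx /H patchE mem_setE.
by rewrite ifT// in_itv/= x0.
Unshelve. all: by end_near. Qed.

End bump_functions.

(** * Du Bois-Reymond's lemma *)

Section du_bois_reymond.
Context {R : realType} (tau : R) (htau : 0 < tau).
Local Notation mu := (@lebesgue_measure R).
Implicit Types (a b c : R) (h : R -> R).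

Let I := [set` `]0, tau[] : set R.
Let mI : measurable I. Proof. exact: measurable_itv. Qed.

Lemma rintegrable_continuous_oo (f : R -> R) : continuous f -> rintegrable I f.
Proof.
move=> cf; apply/rintegrable_cc_oo/continuous_rintegrable.
exact: continuous_subspaceT.
Qed.

Lemma rintegrable_bump a b c : 0 < c -> rintegrable I (bump a b c).
Proof. by move=> c0; apply: rintegrable_continuous_oo; exact: bump_continuous. Qed.

Lemma rintegrable_mul_bump a b c h : 0 < c -> rintegrable I h ->
  rintegrable I (fun x => h x * bump a b c x).
Proof.
move=> c0 hi; apply: rintegrable_bounded_mul => //.
  exact: rintegrable_measurable (rintegrable_bump a b c0).
by move=> x; have /andP[u0 u1] := bump_itv a b x c0; rewrite ger0_norm.
Qed.

Lemma Rintegral_bump_gt0 a b c : 0 < a -> a < b -> b < tau -> 0 < c ->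
  0 < \int[mu]_(x in I) bump a b c x.
Proof.
move=> a0 ab bt c0; have bi := rintegrable_bump a b c0.
have b_ge0 x : 0 <= bump a b c x by have /andP[] := bump_itv a b x c0.
rewrite lt_neqAle Rintegral_ge0 ?andbT//; apply/negP => /eqP e0.
(* Otherwise the bump would vanish almost everywhere, and it does not on ]a, b[. *)
have abs0 : (\int[mu]_(x in I) `|(bump a b c x)%:E| = 0)%E.
  transitivity (\int[mu]_(x in I) (bump a b c x)%:E)%E.
    by apply: eq_integral => x _; rewrite gee0_abs// lee_fin.
  by rewrite -[LHS]fineK; [rewrite [fine _](esym e0)|exact: integrable_fin_num bi].
have mb : measurable_fun I (EFin \o bump a b c).
  by apply/measurable_EFinP; exact: rintegrable_measurable bi.
have := (ae_eq_integral_abs mu mI mb).1 abs0.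
move=> [N [mN N0 sN]].
have : (mu `]a, b[ <= mu N)%E.
  apply: le_measure; rewrite ?inE// => x xab; apply: sN => /= h.
  have xI : I x by apply: subset_itv xab; rewrite bnd_simp ltW.
  by have [] := h xI; apply/eqP; rewrite gt_eqF// bump_gt0.
by rewrite N0 lebesgue_measure_itv/= lte_fin ab -EFinB lee_fin leNgt subr_gt0 ab.
Qed.

(** Du Bois-Reymond's lemma. Fix a bump psi0 of integral m0 <> 0. For any bump psi
    of integral m, chi = psi - (m / m0) psi0 has zero mean, so its primitive is a
    test function and h is orthogonal to chi. With k = (int h psi0) / m0 this says
    that h - k is orthogonal to psi, and the fundamental lemma applies. *)
Lemma du_bois_reymond h : rintegrable I h ->
  (forall phi, test_function tau phi ->
     \int[mu]_(x in I) (h x * derive1 phi x) = 0) ->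
  exists k, \forall x \ae mu, x \in `]0, tau[ -> h x = k.
Proof.
move=> hi h0.
have a00 : 0 < tau / 3 by rewrite divr_gt0.
have ab0 : tau / 3 < tau / 2 by rewrite ltr_pM2l// ltf_pV2 ?posrE ?ltr0n// ltr_nat.
have b0t : tau / 2 < tau by rewrite ltr_pdivrMr// ltr_pMr// ltr1n.
pose psi0 := bump (tau / 3) (tau / 2) 1.
pose m0 := \int[mu]_(x in I) psi0 x.
have m0_gt0 : 0 < m0 by exact: Rintegral_bump_gt0.
have m0_neq0 : m0 != 0 by rewrite gt_eqF.
have hpsi0 : rintegrable I (fun x => h x * psi0 x) by exact: rintegrable_mul_bump.
pose k := (\int[mu]_(x in I) (h x * psi0 x)) / m0.
have ki : rintegrable I (fun x => h x - k).
  apply: rintegrableB => //; apply: rintegrable_continuous_oo; exact: cst_continuous.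
exists k; suff : \forall x \ae mu, x \in `]0, tau[ -> h x - k = 0.
  have ff : Filter (almost_everywhere mu) by exact: ae_filter_ringOfSetsType.
  by apply: (@filterS _ _ ff) => x + xI => /(_ xI)/eqP; rewrite subr_eq0 => /eqP.
apply: bump_fundamental ki _ => a b c a0 ab bt c0.
pose psi := bump a b c; pose m := \int[mu]_(x in I) psi x.
have hpsi : rintegrable I (fun x => h x * psi x) by exact: rintegrable_mul_bump.
have psii : rintegrable I psi by exact: rintegrable_bump.
have psi0i : rintegrable I psi0 by exact: rintegrable_bump.
pose chi x := psi x + (- (m / m0)) * psi0 x.
have chiC n : Ck n chi.
  by apply: CkD; [exact: Ck_bump|apply: CkM; [exact: Ck_cst|exact: Ck_bump]].
have chic : continuous chi by exact: Ck1_continuous.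
have chi_out x : x \notin `]Num.min a (tau / 3), Num.max b (tau / 2)[ -> chi x = 0.
  move=> xn; rewrite /chi /psi /psi0 !bump_out ?mulr0 ?addr0//.
  - apply: contra xn; apply: subset_itv; rewrite bnd_simp.
      by rewrite ge_min lexx orbT.
    by rewrite le_max lexx orbT.
  - apply: contra xn; apply: subset_itv; rewrite bnd_simp.
      by rewrite ge_min lexx.
    by rewrite le_max lexx.
have am0 : 0 < Num.min a (tau / 3) by rewrite lt_min a0.
have bmt : Num.max b (tau / 2) < tau by rewrite gt_max bt.
have chiI : chi = chi \_ I.
  apply/funext => x; rewrite patchE; case: ifPn => // xI.
  apply: chi_out; move: xI; rewrite mem_setE; apply: contra; apply: subset_itv.
    by rewrite bnd_simp ltW.
  by rewrite bnd_simp ltW.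
have chii : rintegrable setT chi.
  by rewrite chiI; apply: rintegrable_patch => //; exact: rintegrable_continuous_oo.
have chi0 : \int[mu]_(x in I) chi x = 0.
  rewrite RintegralD//; last exact: rintegrableZ.
  by rewrite RintegralZl// -/m -/m0 mulNr divfK// subrr.
pose phi (x : R) := \int[mu]_(t in `]-oo, x]) chi t.
have dphi (x : R) : is_derive x (1 : R) phi (chi x).
  have ix : rintegrable `]-oo, (x + 1)] chi by apply: integrableS chii.
  have xx1 : x < x + 1 by rewrite ltrDl.
  have [d1 d2] := continuous_FTC1 xx1 ix (ltNyr _) (chic x).
  by apply: DeriveDef d1 _; rewrite -derive1E.
have phi_test : test_function tau phi.
  split.
    by apply: Ck_derivable => -[//|n]; exists chi.
  exists (Num.min a (tau / 3)), (Num.max b (tau / 2)); split => // x.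
  rewrite in_itv/= negb_and -!ltNge => /orP[xa|bx].
    rewrite /phi -[RHS](@Rintegral_set0 _ _ _ mu chi) Rintegral_mkcond [RHS]Rintegral_mkcond.
    apply: eq_Rintegral => y _; rewrite !patchE in_set0; case: ifPn => //.
    rewrite mem_setE in_itv/= => yx; apply: chi_out.
    by rewrite in_itv/= ltNge (le_trans yx (ltW xa)).
  rewrite -chi0 /phi [RHS]Rintegral_mkcond -chiI Rintegral_mkcond.
  apply: eq_Rintegral => y _; rewrite patchE; case: ifPn => //.
  rewrite mem_setE in_itv/= -ltNge => xy; apply/esym/chi_out.
  by rewrite in_itv/= negb_and -!leNgt (ltW (lt_trans bx xy)) orbT.
have := h0 phi phi_test.
have -> : derive1 phi = chi.
  by apply/funext => y; rewrite derive1E; exact: (@derive_val _ _ _ _ _ _ _ (dphi y)).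
have -> : \int[mu]_(x in I) (h x * chi x) =
    \int[mu]_(x in I) (h x * psi x) - m / m0 * \int[mu]_(x in I) (h x * psi0 x).
  rewrite -RintegralZl// -RintegralB//; last exact: rintegrableZ.
  by apply: eq_Rintegral => x _; rewrite /chi; ring.
move=> /eqP; rewrite subr_eq0 => /eqP e.
transitivity (\int[mu]_(x in I) (h x * psi x) - \int[mu]_(x in I) (k * psi x)).
  rewrite -RintegralB//; last exact: rintegrableZ.
  by apply: eq_Rintegral => x _; rewrite mulrBl.
by rewrite RintegralZl// e /k -/m; apply/eqP; rewrite subr_eq0; apply/eqP; ring.
Qed.

End du_bois_reymond.

(** * Sobolev functions vanishing at 0 as iterated primitives *)

Section sobolev.
Context {R : realType} (tau : R) (htau : 0 < tau).
Local Notation mu := (@lebesgue_measure R).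
Implicit Types (f g h : R -> R[i]) (phi : R -> R).

Let I := [set` `]0, tau[] : set R.
Let mI : measurable I. Proof. exact: measurable_itv. Qed.
Let ff : Filter (almost_everywhere mu).
Proof. exact: ae_filter_ringOfSetsType. Qed.
Let tau0 : 0 <= tau := ltW htau.

Lemma ReMr (x : R[i]) (a : R) : Re (x * a%:C) = Re x * a.
Proof. by rewrite mulrC ReZ mulrC. Qed.
Lemma ImMr (x : R[i]) (a : R) : Im (x * a%:C) = Im x * a.
Proof. by rewrite mulrC ImZ mulrC. Qed.

Lemma Re_cintegralMr f (psi : R -> R) :
  Re (cintegral I (fun x => f x * (psi x)%:C)) = \int[mu]_(x in I) (Re (f x) * psi x).
Proof. by apply: eq_Rintegral => x _; rewrite ReMr. Qed.

Lemma Im_cintegralMr f (psi : R -> R) :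
  Im (cintegral I (fun x => f x * (psi x)%:C)) = \int[mu]_(x in I) (Im (f x) * psi x).
Proof. by apply: eq_Rintegral => x _; rewrite ImMr. Qed.

Lemma cintegral_oo_cc f : cintegrable `[0, tau] f -> cintegral I f = cintegral `[0, tau] f.
Proof.
move=> [fr fi].
have oo_cc (u : R -> R) : rintegrable `[0, tau] u ->
    \int[mu]_(x in I) u x = \int[mu]_(x in `[0, tau]) u x.
  move=> ui; have uo : rintegrable `]0, tau] u.
    by apply: integrableS ui => //; apply: subset_itvr; rewrite bnd_simp.
  rewrite -Rintegral_itv_obnd_cbnd// /I Rintegral_itv_bndo_bndc//.
  exact: rintegrable_cc_oo.
by congr (_ +i* _); exact: oo_cc.
Qed.

Lemma cintegrable_cc_oo f : cintegrable `[0, tau] f -> cintegrable I f.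
Proof. by move=> [fr fi]; split; exact: rintegrable_cc_oo. Qed.

Lemma eq_ae_cintegral f g : cintegrable I f -> cintegrable I g ->
  f = g %[ae mu in I] -> cintegral I f = cintegral I g.
Proof.
move=> [fr fi] [gr gi] fg.
have eq_ae (u v : R -> R) : rintegrable I u -> rintegrable I v ->
    u = v %[ae mu in I] -> \int[mu]_(x in I) u x = \int[mu]_(x in I) v x.
  move=> ui vi uv; congr fine; apply: (ae_eq_integral (mu := mu)) => //.
  - exact: measurable_int ui.
  - exact: measurable_int vi.
  - by apply: (@filterS _ _ ff) uv => x h Ix; rewrite h.
by congr (_ +i* _); apply: eq_ae => //; apply: (@filterS _ _ ff) fg => x h Ix; rewrite h.
Qed.

Lemma test_function_derive1 phi : test_function tau phi -> test_function tau (derive1 phi).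
Proof.
move=> [dphi [a [b [a0 bt phi0]]]]; split.
  by move=> n x; have := dphi n.+1 x; rewrite /derive1n iterSr.
exists a, b; split => // x xab.
rewrite derive1E; apply: (@derive_val _ _ _ _ _ _ _ _).
apply: (@near_eq_is_derive R R R (fun=> 0)).
move: xab; rewrite in_itv/= negb_and -!ltNge => /orP[xa|bx].
  near=> y; rewrite phi0// in_itv/= negb_and -ltNge.
  by apply/orP; left; near: y; exact: lt_nbhsl.
near=> y; rewrite phi0// in_itv/= negb_and -!ltNge.
by apply/orP; right; near: y; exact: lt_nbhsr.
Unshelve. all: by end_near. Qed.

Lemma test_function_is_derive phi : test_function tau phi ->
  forall x : R, is_derive x (1 : R) phi (derive1 phi x).
Proof.
by move=> [dphi _] x; rewrite derive1E; apply: DeriveDef => //; exact: dphi 0%N x.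
Qed.

Lemma test_function_continuous phi : test_function tau phi -> continuous phi.
Proof.
move=> [dphi _] x; apply/differentiable_continuous/derivable1_diffP.
exact: dphi 0%N x.
Qed.

Lemma test_function_cderive phi : test_function tau phi ->
  cderive (fun x => (phi x)%:C) (fun x => (derive1 phi x)%:C).
Proof.
move=> tphi x; split => /=; first exact: test_function_is_derive.
exact: is_derive_cst.
Qed.

Lemma test_function_within phi (A : set R) : test_function tau phi ->
  {within A, continuous (fun x => (phi x)%:C)}.
Proof. by move=> /test_function_cderive; exact: cderive_within_continuous. Qed.

Lemma cintegrable_test f phi : test_function tau phi -> cintegrable `[0, tau] f ->
  cintegrable `[0, tau] (fun x => f x * (phi x)%:C).
Proof.
move=> tphi fi; under [X in cintegrable _ X]eq_fun do rewrite mulrC.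
by apply: (cintegrableMl (psi := fun x => (phi x)%:C)) => //; exact: test_function_within.
Qed.

(** Integration by parts; the boundary terms vanish, the primitive being 0 at 0 and
    the test function at tau. *)
Lemma cintegral_primitive_test h phi : test_function tau phi -> cintegrable `[0, tau] h ->
  cintegral I (fun x => cprimitive h x * (derive1 phi x)%:C) =
  - cintegral I (fun x => h x * (phi x)%:C).
Proof.
move=> tphi hi; have tphi' := test_function_derive1 tphi.
have ci : cintegrable `[0, tau] (cprimitive h).
  exact/continuous_cintegrable/cprimitive_continuous.
rewrite !cintegral_oo_cc; [|exact: cintegrable_test..].
have phit : phi tau = 0.
  case: tphi => _ [a [b [a0 bt ->//]]].
  by rewrite in_itv/= negb_and -!ltNge bt orbT.
have := cintegral_by_parts_primitive tau0 hi (test_function_cderive tphi)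
  (test_function_within tphi').
rewrite phit mul0r add0r => e.
under eq_cintegral do rewrite mulrC; rewrite e; congr (- _).
by apply: eq_cintegral => x _; rewrite mulrC.
Qed.

Lemma weak_derivative0 f : weak_derivative tau 0 f f.
Proof. by move=> phi _; rewrite expr0 mul1r. Qed.

Lemma derive1nSr k phi : derive1n k.+1 phi = derive1n k (derive1 phi).
Proof. by rewrite /derive1n iterSr. Qed.

Lemma weak_derivativeS k f h : cintegrable `[0, tau] h ->
  weak_derivative tau k f (cprimitive h) -> weak_derivative tau k.+1 f h.
Proof.
move=> hi fk phi tphi; rewrite derive1nSr (fk _ (test_function_derive1 tphi)).
by rewrite cintegral_primitive_test// exprSr mulrN1 mulNr mulrN.
Qed.

(** Otherwise, by continuity at 0, the constant would be avoided on some ]0, d[,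
    which is not negligible. *)
Lemma ae_cst_at0 (u : R -> R) (k : R) : {within `[0, tau], continuous u} ->
  (\forall x \ae mu, x \in `]0, tau[ -> u x = k) -> u 0 = k.
Proof.
move=> cu uk; apply/eqP; rewrite -subr_eq0; apply: contraT => uk0.
have [_ u0 _] := (continuous_within_itvP _ htau).1 cu.
have /cvgrPdist_lt/(_ `|u 0 - k|) := u0; rewrite normr_gt0 => /(_ uk0) nu.
have : \forall x \near (0:R)^'+, u x <> k.
  by apply: filterS nu => x + uxk; rewrite uxk ltxx.
move=> [e /= e0 eP].
pose d := Num.min e tau.
have d0 : 0 < d by rewrite lt_min e0.
move: uk => [N [mN N0 sN]].
have : (mu `]0%R, d[ <= mu N)%E.
  apply: le_measure; rewrite ?inE// => x; rewrite /= in_itv/= => /andP[x0].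
  rewrite lt_min => /andP[xe xt]; apply: sN => /= h.
  apply: (eP x) => //; last by apply: h; rewrite in_itv/= x0.
  by rewrite /ball_/= sub0r normrN gtr0_norm.
by rewrite N0 lebesgue_measure_itv/= lte_fin d0 -EFinB lee_fin leNgt subr0 d0.
Qed.

(** Let G be the continuous representative of the k-th derivative. Both G and the
    primitive of h have weak derivative h, so they differ by a constant, which is
    zero as both vanish at 0. *)
Lemma weak_derivative_primitive k f h : cintegrable `[0, tau] h ->
  weak_derivative tau k.+1 f h -> derivative_at0 tau k f 0 ->
  weak_derivative tau k f (cprimitive h).
Proof.
move=> hi fSk [G [cG fk G0]].
have cP : {within `[0, tau], continuous (cprimitive h)} by exact: cprimitive_continuous.
have Gi := continuous_cintegrable cG; have Pi := continuous_cintegrable cP.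
have GP phi : test_function tau phi ->
    cintegral I (fun x => G x * (derive1 phi x)%:C) =
    cintegral I (fun x => cprimitive h x * (derive1 phi x)%:C).
  move=> tphi; have tphi' := test_function_derive1 tphi.
  have := fSk _ tphi; rewrite derive1nSr (fk _ tphi') exprSr mulrN1 mulNr -mulrN.
  rewrite -/I -cintegral_primitive_test//.
  by apply: mulfI; rewrite signr_eq0.
have P0 : cprimitive h 0 = 0.
  by rewrite /cprimitive /cintegral set_itv1 !Rintegral_set1.
have /within_continuous_complexP[Gr Gim] := cG.
have /within_continuous_complexP[Pr Pim] := cP.
have key (u v : R -> R) : {within `[0, tau], continuous u} ->
    {within `[0, tau], continuous v} -> u 0 = 0 -> v 0 = 0 ->
    (forall phi, test_function tau phi ->
      \int[mu]_(x in I) (u x * derive1 phi x) = \int[mu]_(x in I) (v x * derive1 phi x)) ->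
    u = v %[ae mu in I].
  move=> cu cv u0 v0 uv.
  have ui := continuous_rintegrable cu; have vi := continuous_rintegrable cv.
  have uvi : rintegrable I (fun x => u x - v x).
    by apply: rintegrableB => //; exact: rintegrable_cc_oo.
  have [|k0 uvk] := du_bois_reymond htau uvi.
    move=> phi tphi; have cphi' := test_function_continuous (test_function_derive1 tphi).
    have mi (w : R -> R) : rintegrable `[0, tau] w ->
        rintegrable I (fun x => w x * derive1 phi x).
      move=> wi; apply: rintegrable_cc_oo.
      under [X in rintegrable _ X]eq_fun do rewrite mulrC.
      by apply: rintegrableMl => //; exact: continuous_subspaceT.
    under eq_Rintegral do rewrite mulrBl.
    by rewrite RintegralB//; [rewrite uv// subrr|exact: mi|exact: mi].
  have cuv : {within `[0, tau], continuous (fun x => u x - v x)}.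
    by move=> x; apply: cvgB; [exact: cu|exact: cv].
  have := ae_cst_at0 cuv uvk; rewrite u0 v0 subrr => k00.
  apply: (@filterS _ _ ff) uvk => x + xI => /(_ xI)/eqP.
  by rewrite -k00 subr_eq0 => /eqP.
have aeR : (fun x => Re (G x)) = (fun x => Re (cprimitive h x)) %[ae mu in I].
  apply: key => //; [by rewrite G0|by rewrite P0|] => phi /GP/(congr1 (fun z => Re z)).
  by rewrite !Re_cintegralMr.
have aeI : (fun x => Im (G x)) = (fun x => Im (cprimitive h x)) %[ae mu in I].
  apply: key => //; [by rewrite G0|by rewrite P0|] => phi /GP/(congr1 (fun z => Im z)).
  by rewrite !Im_cintegralMr.
move=> phi tphi; rewrite (fk _ tphi); congr (_ * _).
apply: eq_ae_cintegral; [exact/cintegrable_cc_oo/cintegrable_test..|].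
apply: (@filterS2 _ _ ff) aeR aeI => x /= xr xi xI.
by congr (_ * _); apply: complexP; [exact: xr|exact: xi].
Qed.

Lemma weak_derivative0_ae f g : square_integrable tau f -> square_integrable tau g ->
  weak_derivative tau 0 f g -> f = g %[ae mu in I].
Proof.
move=> f2 g2 fg.
have fi := square_integrable_cintegrable f2; have gi := square_integrable_cintegrable g2.
have key (u v : R -> R) : rintegrable I u -> rintegrable I v ->
    (forall phi, test_function tau phi ->
      \int[mu]_(x in I) (u x * phi x) = \int[mu]_(x in I) (v x * phi x)) ->
    u = v %[ae mu in I].
  move=> ui vi uv.
  have uvi : rintegrable I (fun x => u x - v x) by exact: rintegrableB.
  have uv0 : \forall x \ae mu, x \in `]0, tau[ -> u x - v x = 0.
    apply: bump_fundamental uvi _ => a b c a0 ab bt c0.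
    under eq_Rintegral do rewrite mulrBl.
    rewrite RintegralB//; try exact: rintegrable_mul_bump.
    by rewrite uv ?subrr//; exact: test_function_bump.
  by apply: (@filterS _ _ ff) uv0 => x + xI => /(_ xI)/eqP; rewrite subr_eq0 => /eqP.
have fg' phi : test_function tau phi ->
    cintegral I (fun x => f x * (phi x)%:C) = cintegral I (fun x => g x * (phi x)%:C).
  by move=> /fg; rewrite expr0 mul1r.
have [fr fim] := cintegrable_cc_oo fi; have [gr gim] := cintegrable_cc_oo gi.
have aeR : (fun x => Re (f x)) = (fun x => Re (g x)) %[ae mu in I].
  apply: key => // phi /fg'/(congr1 (fun z => Re z)).
  by rewrite !Re_cintegralMr.
have aeI : (fun x => Im (f x)) = (fun x => Im (g x)) %[ae mu in I].
  apply: key => // phi /fg'/(congr1 (fun z => Im z)).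
  by rewrite !Im_cintegralMr.
apply: (@filterS2 _ _ ff) aeR aeI => x /= xr xi xI.
by apply: complexP; [exact: xr|exact: xi].
Qed.

Lemma iter_cprimitive_continuous j g : square_integrable tau g ->
  {within `[0, tau], continuous (iter j.+1 cprimitive g)}.
Proof.
move=> g2; elim: j => [|j ih].
  by apply: cprimitive_continuous => //; exact: square_integrable_cintegrable.
by rewrite iterS; apply: cprimitive_continuous => //; exact: continuous_cintegrable.
Qed.

Lemma iter_cprimitive_square_integrable j g : square_integrable tau g ->
  square_integrable tau (iter j cprimitive g).
Proof.
case: j => // j g2; apply: continuous_square_integrable.
exact: iter_cprimitive_continuous.
Qed.

(** The forward inclusion integrates the L-th weak derivative g of f back: by
    descending induction, the k-th derivative of f is the (L - k)-fold primitive of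
    g, until the case k = 0 gives f itself. *)
Lemma H0_iter_cprimitive L :
  H0 tau L = [set ae_class tau (iter L cprimitive g) | g in square_integrable tau].
Proof.
apply/seteqP; split=> _ [f f2 <-]; last first.
  have si j := square_integrable_cintegrable (iter_cprimitive_square_integrable j f2).
  have wd k : (k <= L)%N ->
      weak_derivative tau k (iter L cprimitive f) (iter (L - k) cprimitive f).
    elim: k => [_|k ih kL]; first by rewrite subn0; exact: weak_derivative0.
    apply: weak_derivativeS => //; have := ih (ltnW kL).
    by rewrite -(subnSK kL).
  exists (iter L cprimitive f) => //; split.
    split; first exact: iter_cprimitive_square_integrable.
    move=> k kL; exists (iter (L - k) cprimitive f); last exact: wd.
    exact: iter_cprimitive_square_integrable.
  move=> k kL; exists (iter (L - k) cprimitive f); split.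
  - by rewrite -(subnSK kL); exact: iter_cprimitive_continuous.
  - by apply: wd; exact: ltnW.
  - by rewrite -(subnSK kL) iterS /cprimitive /cintegral set_itv1 !Rintegral_set1.
case: f2 => -[f2 fL] f0.
have [g g2 fg] := fL L (leqnn L).
exists g => //; apply: ae_class_eq_ae.
have wd j : (j <= L)%N -> weak_derivative tau (L - j) f (iter j cprimitive g).
  elim: j => [_|j ih jL]; first by rewrite subn0.
  apply: weak_derivative_primitive.
  - exact: square_integrable_cintegrable (iter_cprimitive_square_integrable j g2).
  - by rewrite subnSK//; exact: ih (ltnW jL).
  - by apply: f0; rewrite ltn_subrL (leq_trans _ jL).
apply: ae_eq_sym; apply: weak_derivative0_ae => //.
  exact: iter_cprimitive_square_integrable.
by have := wd L (leqnn L); rewrite subnn.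
Qed.

End sobolev.

(** * The alternative *)

Theorem proposition6 (R : realType) (d p : nat) (hd : (1 <= d)%N)
    (hp : (1 <= p)%N) (A : 'M[R[i]]_d) (B : 'M[R[i]]_(d, p))
    (C : 'M[R[i]]_(1, d)) (D : 'M[R[i]]_(1, p)) (tau : R) (htau : 0 < tau) :
  [/\ D <> 0 -> io_range A B C D tau = L2 tau,
      D = 0 -> (forall k, (k <= d.-1)%N -> C *m A ^+ k *m B = 0) ->
        io_range A B C D tau = [set ae_class tau (fun=> 0)] &
      forall nu, (nu <= d.-1)%N -> D = 0 ->
        (forall k, (k < nu)%N -> C *m A ^+ k *m B = 0) ->
        C *m A ^+ nu *m B <> 0 ->
        io_range A B C D tau = H0 tau nu.+1].
Proof.
split.
- exact: io_range_feedthrough.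
- by move=> ->; exact: io_range_zero.
- move=> nu _ -> CAB CAB0.
  by rewrite (io_range_integrated htau CAB CAB0) H0_iter_cprimitive.
Qed.
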